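(* Let $\mathcal G'$ be a given subset of $\mathrm{int}(\mathcal G)$, let the environment be oblivious with cost functions $\boldsymbol f=(f_1,\dots,f_T)\in\mathcal F^T$, let $\nu_1,\dots,\nu_T$ be generated by the mirror descent algorithm with learning rate $\rho>0$, and let $\widehat{\boldsymbol\gamma}$ be the strategy that at time $t$ draws $U_t\sim P_t(\cdot|X_t)$ with $P_t=P_{\nu_t}$. Suppose that $\rho\|f_t\|^*_{\nabla F(\nu_t)}\le1/2$ and $\|f_t\|^*_{\nabla F(\nu_t)}\le1$ for all $t=1,\dots,T$, and that the uniform mixing condition is satisfied with constant $\tau$. Then, for the relaxation $$\widehat V_T(\mathcal G'|f_1,\dots,f_t)=\sup_{\mu\in\mathcal G'}\Big\{\sum_{s=1}^t\langle\mu,-f_s\rangle+\frac1\rho D_F(\mu,\nu_{t+1})\Big\}+2\rho(T-t),\quad t=0,\dots,T,$$ and the corresponding (mirror descent) algorithm, for the initial state $x\in\mathsf X$, $$\mathbb E_x^{\widehat{\boldsymbol\gamma},\boldsymbol f}\Big[\sum_{t=1}^Tf_t(X_t,U_t)-\inf_{P\in\mathcal M(\mathcal G')}\sum_{t=1}^T\langle\pi_P\otimes P,f_t\rangle\Big]\le\frac{D_F(\mathcal G')}{\rho}+2\rho T+C_{\mathcal F}(\tau+1)^2T\Delta_T+(2\tau+2)C_{\mathcal F},$$ where $D_F(\mathcal G')=\sup_{\nu\in\mathcal G'}D_F(\nu,\nu_1)$, $C_{\mathcal F}=\sup_{f\in\mathcal F}\|f\|_\infty$ and $\Delta_T=\max_{2\le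 t\le T}\max_{y\in\mathsf X}\|P_{t-1}(\cdot|y)-P_t(\cdot|y)\|_1$.
   Context: $\mathsf X,\mathsf U$ are finite sets (states, actions); $K(y|x,u)$ is a fixed transition kernel; $\mathcal P(\cdot)$ denotes the set of probability distributions on a finite set; $\mathcal M(\mathsf U|\mathsf X)$ is the set of Markov matrices $P=[P(u|x)]$ with $P(\cdot|x)\in\mathcal P(\mathsf U)$; $K(y|x,P)=\sum_uK(y|x,u)P(u|x)$, and $\mu K(\cdot|P)$ is the distribution $y\mapsto\sum_x\mu(x)K(y|x,P)$. $\|\cdot\|_1$ is the $\ell_1$ norm; $(\pi\otimes P)(x,u)=\pi(x)P(u|x)$; $\langle\nu,f\rangle=\sum_{x,u}\nu(x,u)f(x,u)$. $\mathcal F$ is a fixed class of functions $\mathsf X\times\mathsf U\to\mathbb R$; $T$ is a fixed finite horizon. Uniform mixing condition: there is a finite constant $\tau\ge1$ such that $\|\mu_1K(\cdot|P)-\mu_2K(\cdot|P)\|_1\le e^{-1/\tau}\|\mu_1-\mu_2\|_1$ for all $P\in\mathcal M(\mathsf U|\mathsf X)$ and $\mu_1,\mu_2\in\mathcal P(\mathsf X)$. In particular each $K(\cdot|\cdot,P)$ has a unique invariant distribution $\pi_P$. Game: $X_1=x$. For $t=1,\dots,T$: the agent observes $X_t$ and draws $U_t$ from a distribution depending on $X_t$ and $f_1,\dots,f_{t-1}$; $f_t\in\mathcal F$ is revealed; the cost $f_t(X_t,U_t)$ is incurred; $X_{t+1}\sim K(\cdot|X_t,U_t)$. Oblivious means that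 $\boldsymbol f$ is not affected by states or actions. State-action polytope: $\mathcal G=\{\nu\in\mathcal P(\mathsf X\times\mathsf U):\sum_{x,u}K(y|x,u)\nu(x,u)=\sum_u\nu(y,u)\ \forall y\in\mathsf X\}$. It is taken to be a compact convex subset of $\mathbb R^{|\mathsf X|\times|\mathsf U|}$ with nonempty interior $\mathrm{int}(\mathcal G)$. Each $\nu\in\mathcal G$ induces a policy $P_\nu(u|x)=\nu(x,u)/\sum_v\nu(x,v)$ (for states $x$ at which the denominator is nonzero), and $\mathcal M(\mathcal G')$ is the set of policies of the form $P_\nu$ with $\nu\in\mathcal G'$. Let $\mathcal K\subseteq\mathbb R^n$ be closed, convex, with nonempty interior. A function $F:\mathrm{int}(\mathcal K)\to\mathbb R$ is a barrier on $\mathcal K$ if $F(x_i)\to+\infty$ along any sequence of points of $\mathrm{int}(\mathcal K)$ converging to a boundary point of $\mathcal K$. It is self-concordant if it is convex, $C^3$, and $\nabla^3F(v)[h,h,h]\le2(\nabla^2F(v)[h,h])^{3/2}$ for all $v\in\mathrm{int}(\mathcal K)$, $h\in\mathbb R^n$. The Bregman divergence is $D_F(v,w)=F(v)-F(w)-\langle\nabla F(w),v-w\rangle$, $v,w\in\mathrm{int}(\mathcal K)$. The Legendre–Fenchel dual is $F^*(h)=\sup_{v\in\mathrm{int}(\mathcal K)}\{\langle h,v\rangle-F(v)\}$, and the dual local norm of $f$ at $h$ is $\|f\|^*_h=\sqrt{\langle f,\nabla^2F^*(h)f\rangle}$. Standing assumption (with $\mathcal K=\mathcal G$): $\mathcal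 G$ admits a self-concordant barrier $F:\mathrm{int}(\mathcal G)\to\mathbb R$ such that (1) $F$ is strictly convex on $\mathrm{int}(\mathcal G)$ and $F^*$ is strictly convex on $\mathbb R^{|\mathsf X|\times|\mathsf U|}$; (2) the gradient map $\nu\mapsto\nabla F(\nu)$ is a bijection between $\mathrm{int}(\mathcal G)$ and $\mathbb R^{|\mathsf X|\times|\mathsf U|}$ with inverse $h\mapsto\nabla F^*(h)$; (3) the minimum value of $F$ on $\mathrm{int}(\mathcal G)$ is $0$. Mirror descent algorithm with learning rate $\rho>0$: $\nu_1=\operatorname{arg\,min}_{\nu\in\mathrm{int}(\mathcal G)}F(\nu)$ and, for $t\ge2$, $\nu_t=\nabla F^*\big(\nabla F(\nu_{t-1})-\rho f_{t-1}\big)$.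
   Formalization: Since G lies in the hyperplane of total mass 1, its interior is empty; int(G) is read as the relative interior, the gradient of F is taken along the linear space parallel to G's affine hull, and the bijection and strict convexity of F* are required on that space only. *)

(* Defs.v *)
From HB Require Import structures.
From mathcomp Require Import all_boot all_order all_algebra.
From mathcomp Require Import all_classical all_reals all_analysis.
Import Order.TTheory GRing.Theory Num.Theory.
Import numFieldNormedType.Exports.
Set Implicit Arguments.
Unset Strict Implicit.
Unset Printing Implicit Defensive.
Local Open Scope classical_set_scope.
Local Open Scope ring_scope.

(* Convex analysis relative to the affine hull.  A state-action polytope lies
   in the hyperplane of total mass one, so its interior in the space of all
   matrices is empty.  Interiors are therefore taken relative to the affine
   hull, and differential conditions are imposed along [direction C], the
   linear space parallel to it.  When C has nonempty interior, [direction C] is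
   the whole space and every notion below is the usual full-dimensional one. *)
Section ConvexAnalysis.
Context {R : realType} {m n : nat}.
Local Notation E := 'M[R]_(m, n).
Implicit Types (C L S : set E) (F : E -> R) (v w h g : E).

Definition dotp g h : R := \sum_i \sum_j g i j * h i j.

Definition direction C : set E :=
  [set h | exists (k : nat) (c : 'I_k -> R) (v w : 'I_k -> E),
    (forall i, C (v i) /\ C (w i)) /\ h = \sum_i c i *: (v i - w i)].

Definition relint C : set E :=
  [set v | C v /\ \forall h \near (0 : E), direction C h -> C (v + h)].

(* C^k on S along the directions of L.  For S = relint C and L = direction C
   this only depends on the values of F on relint C. *)
Fixpoint Ck_on L S (k : nat) F : Prop :=
  {within S, continuous F} /\
  if k is k'.+1 then
    forall h, L h ->
      (forall v, S v -> derivable F v h) /\ Ck_on L S k' ('D_h F)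
  else True.

(* The gradient as a vector of L; L = setT gives the ordinary gradient. *)
Definition grad L F v : E :=
  get [set g | L g /\ forall h, L h -> is_derive v h F (dotp g h)].

Definition strictly_convex_on S F : Prop :=
  forall v w (t : R), S v -> S w -> v != w -> 0 < t < 1 ->
    F (t *: v + (1 - t) *: w) < t * F v + (1 - t) * F w.

Definition barrier C F : Prop :=
  forall (u : nat -> E) v, (forall i, relint C (u i)) ->
    u @ \oo --> v -> (closure C `\` relint C) v -> F (u i) @[i --> \oo] --> +oo.

Definition self_concordant C F : Prop :=
  [/\ convex_function (relint C : set (convex_lmodType E)) F,
      Ck_on (direction C) (relint C) 3 F &
      forall v h, relint C v -> direction C h ->
        'D_h ('D_h ('D_h F)) v <= 2 * ('D_h ('D_h F) v) `^ (3 / 2)].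

Definition bregman C F v w : R :=
  F v - F w - dotp (grad (direction C) F w) (v - w).

(* Legendre-Fenchel dual, on the whole space; [sup] is meant for functions F
   that make it finite, e.g. F bounded below and C bounded. *)
Definition fdual C F h : R := sup [set dotp h v - F v | v in relint C].

Definition dual_norm C F h g : R := Num.sqrt ('D_g ('D_g (fdual C F)) h).

(* If C has empty interior, fdual C F is affine along the orthogonal complement
   of [direction C], so strict convexity of the dual and surjectivity of the
   gradient can only be asked on [direction C]. *)
Record mirror_barrier C F : Prop := MirrorBarrier {
  mb_barrier : barrier C F;
  mb_self_concordant : self_concordant C F;
  mb_strict : strictly_convex_on (relint C) F;
  mb_strict_dual : strictly_convex_on (direction C) (fdual C F);
  mb_grad_bij : set_bij (relint C) (direction C) (grad (direction C) F);
  mb_grad_inv : forall h, direction C h ->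
    relint C (grad setT (fdual C F) h) /\
    grad (direction C) F (grad setT (fdual C F) h) = h;
  mb_min : (exists2 v, relint C v & F v = 0) /\ forall v, relint C v -> 0 <= F v
}.

Definition md_init C F : E :=
  get [set v | relint C v /\ forall w, relint C w -> F v <= F w].

(* [md C F rho [:: f_1; ...; f_(t-1)]] is the iterate nu_t. *)
Definition md C F (rho : R) (fs : seq E) : E :=
  foldl (fun nu f => grad setT (fdual C F) (grad (direction C) F nu - rho *: f))
        (md_init C F) fs.

(* The relaxation of horizon T at the history fs = [:: f_1; ...; f_t]. *)
Definition md_relaxation C F (rho : R) (T : nat) (G' : set E) (fs : seq E) :
    \bar R :=
  (ereal_sup [set (\sum_(f <- fs) dotp mu (- f)
                   + rho^-1 * bregman C F mu (md C F rho fs))%:E | mu in G']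
   + (2 * rho * (T%:R - (size fs)%:R))%:E)%E.

End ConvexAnalysis.

Section MarkovDecisionProcess.
Context {R : realType} {X U : finType}.

(* Functions X * U -> R, as matrices; the norm `|f| of a matrix is the maximum
   of the absolute values of its entries, i.e. the sup norm. *)
Local Notation E := 'M[R]_(#|X|, #|U|).

Definition ent (f : E) (x : X) (u : U) : R := f (enum_rank x) (enum_rank u).

Definition is_dist (A : finType) (p : A -> R) : Prop :=
  (forall a, 0 <= p a) /\ \sum_a p a = 1.

Definition l1dist (A : finType) (p q : A -> R) : R := \sum_a `|p a - q a|.

(* [K x u y] is K(y|x,u) and [P x u] is P(u|x). *)
Implicit Types (K : X -> U -> X -> R) (P : X -> U -> R).

Definition markov_matrix P : Prop := forall x, is_dist (P x).

Definition push K P (mu : X -> R) : X -> R :=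
  fun y => \sum_x mu x * \sum_u K x u y * P x u.

Definition uniform_mixing K (tau : R) : Prop :=
  1 <= tau /\
  forall P (mu1 mu2 : X -> R), markov_matrix P -> is_dist mu1 -> is_dist mu2 ->
    l1dist (push K P mu1) (push K P mu2) <= expR (- tau^-1) * l1dist mu1 mu2.

(* Well defined under uniform mixing, which gives a unique such distribution. *)
Definition inv_dist K P : X -> R :=
  get [set pi : X -> R | is_dist pi /\ push K P pi = pi].

Definition otimes (pi : X -> R) P : E :=
  \matrix_(i, j) (pi (enum_val i) * P (enum_val i) (enum_val j)).

Definition polytope K : set E :=
  [set nu | [/\ (forall x u, 0 <= ent nu x u),
                \sum_x \sum_u ent nu x u = 1 &
                forall y, \sum_x \sum_u K x u y * ent nu x u
                          = \sum_u ent nu y u]].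

(* P is of the form P_nu: arbitrary at the states of nu-mass zero, where the
   defining quotient is meaningless. *)
Definition induced_policy (nu : E) P : Prop :=
  markov_matrix P /\
  forall x u, \sum_v ent nu x v != 0 -> P x u = ent nu x u / \sum_v ent nu x v.

Definition policies (G' : set E) : set (X -> U -> R) :=
  [set P | exists2 nu, G' nu & induced_policy nu P].

(* [gam [:: f_1; ...; f_(t-1)] x u] is the probability of U_t = u if X_t = x. *)
Definition strategy := seq E -> X -> U -> R.

(* Trajectories (X_1, ..., X_(T+1)) and (U_1, ..., U_T), with time shifted to
   start at 0. *)
Definition trajectory (T : nat) : Type :=
  ({ffun 'I_T.+1 -> X} * {ffun 'I_T -> U})%type.

Definition state_at T (w : trajectory T) (t : 'I_T) : X :=
  w.1 (widen_ord (leqnSn T) t).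
Definition next_state T (w : trajectory T) (t : 'I_T) : X := w.1 (lift ord0 t).
Definition action_at T (w : trajectory T) (t : 'I_T) : U := w.2 t.

(* Law of the trajectory against an oblivious environment playing f. *)
Definition traj_law K T (gam : strategy) (f : T.-tuple E) (x : X)
    (w : trajectory T) : R :=
  (w.1 ord0 == x)%:R *
  \prod_(t < T) (gam (take t f) (state_at w t) (action_at w t)
                 * K (state_at w t) (action_at w t) (next_state w t)).

(* In the extended reals, since the comparator may be an infimum over an empty
   set of policies. *)
Definition expect K T (gam : strategy) (f : T.-tuple E) (x : X)
    (Z : trajectory T -> \bar R) : \bar R :=
  (\sum_(w : {ffun 'I_T.+1 -> X} * {ffun 'I_T -> U})
     (traj_law K gam f x w)%:E * Z w)%E.

Definition total_cost T (f : T.-tuple E) (w : trajectory T) : R :=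
  \sum_(t < T) ent (tnth f t) (state_at w t) (action_at w t).

Definition best_cost K T (G' : set E) (f : T.-tuple E) : \bar R :=
  ereal_inf [set (\sum_(t < T) dotp (otimes (inv_dist K P) P) (tnth f t))%:E
            | P in policies G'].

(* The largest l1 distance between the policies of consecutive rounds; 0 if
   there is only one round. *)
Definition policy_drift T (gam : strategy) (f : T.-tuple E) : R :=
  \big[Num.max/0]_(1 <= t < T) \big[Num.max/0]_(y : X)
     l1dist (gam (take t.-1 f) y) (gam (take t f) y).

End MarkovDecisionProcess.

(* Main.v *)
Require Import Defs.
From HB Require Import structures.
From mathcomp Require Import all_boot all_order all_algebra.
From mathcomp Require Import all_classical all_reals all_analysis.
From mathcomp Require Import ring lra.
Import Order.TTheory GRing.Theory Num.Theory.
Import numFieldNormedType.Exports.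
Set Implicit Arguments.
Unset Strict Implicit.
Unset Printing Implicit Defensive.
Local Open Scope classical_set_scope.
Local Open Scope ring_scope.

(** Regret.  Let [nu_t] be the mirror descent iterates and [w = nu_(t+1)],
    [v = nu_t], [k = w - v].  The three-point identity for Bregman divergences
    bounds [rho <v - mu, f_t>] by [D(mu, v) - D(mu, w)] plus the symmetrised
    divergence [<grad F w - grad F v, k> = - rho <f_t, k>].  With
    [r^2 = F''(v)[k, k]], self-concordance along the segment from [v] to [w]
    bounds this quantity below by [r^2 / (1 + r)], and Cauchy-Schwarz bounds it
    above by [rho q r], [q] being the dual local norm of [f_t].  Since
    [rho q <= 1/2], this gives [r <= 2 rho q], so that each round costs at most
    [2 rho^2 q^2 <= 2 rho^2].

    Dual norm.  The number [q] is defined in the statement through the second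
    derivative of [F^*], whose existence has to be proved.  Set
    [q = sup {<f, k> | F''(v)[k, k] < 1}]; it is finite because the Dikin
    ellipsoid of [v] lies in the bounded set [C].  The primal bounds
    [r^2 / (2 (1 + r)) <= D(v + k, v) <= r^2 / (2 (1 - r))] dualise to
    two-sided estimates of [F^*(h + s f)] around [h = grad F v], which show that
    [F^*] is differentiable with gradient [v] and that
    [<f, grad F^*(h + s f) - v> / s] tends to [q^2].

    Tracking.  Each [nu_t] is [pi_t (x) P_t] with [pi_t] invariant under [P_t].
    The law [mu_t] of [X_t] contracts towards [pi_t] by [a = e^(-1/tau)] in each
    round, where [1 / (1 - a) <= tau + 1], while [pi_t] itself moves by at most
    [(tau + 1) Delta]; summing the recursion
    [|mu_(t+1) - pi_(t+1)| <= a |mu_t - pi_t| + (tau + 1) Delta] gives the last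
    two terms of the bound. *)

(** * Self-concordant functions of one variable *)

(** Remainder estimates, such as those for [fdual] below, become derivatives through this form; the
    non-strict bound also covers [t = 0]. *)
Lemma is_deriveP {R : realType} {V : normedModType R} (F : V -> R) (v h : V) (l : R) :
  is_derive v h F l <->
  forall e, 0 < e -> exists2 d, 0 < d &
    forall t, `|t| < d -> `|F (v + t *: h) - F v - t * l| <= e * `|t|.
Proof.
have E t : t != 0 -> `|F (v + t *: h) - F v - t * l| =
    `|l - t^-1 *: ((F \o shift v) (t *: h) - F v)| * `|t|.
  move=> t0; rewrite -normrM -normrN; congr `|_|.
  by rewrite /= [t *: h + v]addrC /GRing.scale /=; field.
split.
  move=> [dF El] e e0.
  have /cvgrPdist_le /(_ e e0) :
      (fun t => t^-1 *: ((F \o shift v) (t *: h) - F v)) @ 0^' --> l.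
    by rewrite -El.
  case/nbhs_ex => d /= H; exists d%:num => // t td.
  have [->|t0] := eqVneq t 0; first by rewrite scale0r addr0 subrr mul0r subr0 normr0 mulr0.
  rewrite E// ler_wpM2r//; apply: H => //.
  by rewrite /ball /= sub0r normrN.
move=> H.
suff c : (fun t => t^-1 *: ((F \o shift v) (t *: h) - F v)) @ 0^' --> l.
  by split; [apply/cvg_ex; exists l | exact: cvg_lim].
apply/cvgrPdist_le => e e0; have [d d0 {}H] := H _ e0.
near=> t; have t0 : t != 0 by near: t; exact: nbhs_dnbhs_neq.
rewrite -(ler_pM2r (_ : 0 < `|t|)) ?normr_gt0// -E//; apply: H.
by near: t; exact: dnbhs0_lt.
Unshelve. all: by end_near. Qed.

Section DirectionalDerivatives.
Context {R : realType} {V : normedModType R}.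
Implicit Types (F : V -> R) (v h : V).

Lemma is_derive_line F v h t (l : R) :
  is_derive (v + t *: h) h F l ->
  is_derive t 1 (fun s => F (v + s *: h)) l.
Proof.
move=> /is_deriveP H; apply/is_deriveP => e /H[d d0 {}H].
exists d => // s sd; have := H s sd; rewrite -[v + _ + _]addrA -scalerDl.
by rewrite [s *: _]mulr1.
Qed.

Lemma is_derive_scale F v h (l a : R) :
  is_derive v h F l -> is_derive v (a *: h) F (a * l).
Proof.
move=> /is_deriveP H; apply/is_deriveP => e e0.
(* The shift by 1 in the divisor covers [a = 0]. *)
have [d d0 {}H] := H (e / (`|a| + 1)) (divr_gt0 e0 (ltr_wpDl (normr_ge0 _) ltr01)).
have a1 : 0 < `|a| + 1 by rewrite ltr_wpDl.
exists (d / (`|a| + 1)); first exact: divr_gt0.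
move=> t; rewrite ltr_pdivlMr// => td; rewrite scalerA mulrA.
apply: le_trans (H _ _) _.
  by rewrite normrM; apply: le_lt_trans td; rewrite ler_wpM2l// lerDl.
have -> : e / (`|a| + 1) * `|t * a| = e * (`|t| * (`|a| / (`|a| + 1))).
  by rewrite normrM; field; rewrite gt_eqF.
rewrite ler_pM2l// ler_piMr// ler_pdivrMr// mul1r lerDl //.
Qed.

(** Only values on a short segment through [v] matter, so identities valid on a relative interior
    alone can be differentiated along its directions. *)
Lemma eq_is_derive F1 F2 v h (l : R) :
  (exists2 d, 0 < d & forall t, `|t| < d -> F1 (v + t *: h) = F2 (v + t *: h)) ->
  is_derive v h F1 l -> is_derive v h F2 l.
Proof.
move=> [d1 d10 E] /is_deriveP H; apply/is_deriveP => e /H[d d0 {}H].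
exists (Num.min d d1); first by rewrite lt_min d0.
have E0 : F1 v = F2 v by have := E 0; rewrite normr0 scale0r addr0; apply.
by move=> t; rewrite lt_min => /andP[/H + /E]; rewrite E0 => + <-.
Qed.

End DirectionalDerivatives.

Lemma powR_three_halves {R : realType} (x : R) : 0 <= x ->
  x `^ (3 / 2) = x * Num.sqrt x.
Proof.
rewrite le_eqVlt => /predU1P[<-|x0]; first by rewrite mul0r powR0// mulf_neq0// invr_eq0.
have -> : 3 / 2 = 1 + 2^-1 :> R by field.
rewrite powRD; last by rewrite gt_eqF ?implybT.
by rewrite powRr1 ?ltW// powR12_sqrt// ltW.
Qed.

(* The one-sided bound in the directions [k] and [- k], where [a] and [b] stand for
   the third and second derivatives along [k]. *)
Lemma two_sided_self_concordance {R : realType} (a a' b b' : R) :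
  a' = - a -> b' = b -> 0 <= b ->
  a <= 2 * b `^ (3 / 2) -> a' <= 2 * b' `^ (3 / 2) ->
  `|a| <= 2 * (b * Num.sqrt b).
Proof.
move=> -> -> b0; rewrite powR_three_halves// ler_norml => -> h.
by rewrite andbT; lra.
Qed.

(** Cancelling [r] gives [r <= sg * (1 + r) <= sg + r / 2]. *)
Lemma local_step_le {R : realType} (r A sg : R) : 0 <= r ->
  r ^+ 2 / (1 + r) <= A -> A <= sg * r -> 0 <= sg <= 1 / 2 -> r <= 2 * sg.
Proof.
move=> r0 h1 h2 /andP[s0 s1]; have h := le_trans h1 h2.
move: h; rewrite ler_pdivrMr; last by rewrite ltr_wpDr.
move: r0; rewrite le_eqVlt => /predU1P[<- _|r0 h]; first by rewrite mulr_ge0.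
have : r <= sg * (1 + r).
  by rewrite -(ler_pM2r r0) -expr2; apply: le_trans h _; lra.
have : sg * r <= 1 / 2 * r by rewrite ler_pM2r.
lra.
Qed.

(** Since [r <= 2 * sg], the last hypothesis gives [(sg^2 + r^2) * (1/2 - sg) <= A]. Multiplied by
    [sg^2] and combined with [A^2 <= sg^2 * r^2], it becomes
    [(A - sg^2)^2 <= 2 * sg * (A^2 + sg^4)], and [A <= 2 * sg^2] yields the constant 10. Thus
    [A = sg^2 + O(sg^(5/2))]. *)
Lemma second_order_gap {R : realType} (r A sg : R) : 0 <= r -> r <= 2 * sg ->
  0 <= sg <= 1 / 2 -> 0 <= A -> A <= sg * r ->
  sg ^+ 2 - sg ^+ 2 / (2 * (1 - sg)) + r ^+ 2 / (2 * (1 + r)) <= A ->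
  (A - sg ^+ 2) ^+ 2 <= 10 * sg ^+ 5.
Proof.
move=> r0 rs /andP[s0 s1] A0 Ar h.
have [sE|sN0] := eqVneq sg 0; first rewrite sE in Ar *.
  have -> : A = 0 by apply/le_anti; rewrite A0 andbT; apply: le_trans Ar _; rewrite mul0r.
  by rewrite !expr0n subrr expr0n mulr0.
have sp : 0 < sg by rewrite lt_neqAle eq_sym sN0.
have e1 : sg ^+ 2 / (2 * (1 - sg)) <= sg ^+ 2 * (1 / 2 + sg).
  rewrite ler_pM2l ?exprn_gt0// -[X in X <= _]mul1r ler_pdivrMr; last by lra.
  nra.
have e2 : r ^+ 2 * (1 / 2 - sg) <= r ^+ 2 / (2 * (1 + r)).
  rewrite ler_wpM2l ?sqr_ge0// -[X in _ <= X]mul1r ler_pdivlMr; last by lra.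
  nra.
have e3 : A ^+ 2 <= sg ^+ 2 * r ^+ 2 by rewrite -exprMn ler_sqr ?nnegrE// mulr_ge0.
have e4 : sg ^+ 2 * (1 / 2 - sg) + r ^+ 2 * (1 / 2 - sg) <= A by lra.
have e5 : sg ^+ 2 * (sg ^+ 2 * (1 / 2 - sg) + r ^+ 2 * (1 / 2 - sg)) <= sg ^+ 2 * A.
  by rewrite ler_wpM2l// sqr_ge0.
have e6 : A ^+ 2 * (1 / 2 - sg) <= sg ^+ 2 * r ^+ 2 * (1 / 2 - sg).
  by rewrite ler_wpM2r//; lra.
have e7 : A ^+ 2 <= 4 * sg ^+ 4.
  apply: le_trans e3 _.
  have : r ^+ 2 <= (2 * sg) ^+ 2 by rewrite ler_sqr ?nnegrE// mulr_ge0.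
  have s2 := sqr_ge0 sg; nra.
have e8 : A ^+ 2 * sg <= 4 * sg ^+ 4 * sg by rewrite ler_wpM2r.
have -> : (A - sg ^+ 2) ^+ 2 = A ^+ 2 - 2 * (sg ^+ 2 * A) + sg ^+ 4 by ring.
have -> : sg ^+ 5 = sg ^+ 4 * sg by ring.
have : sg ^+ 2 * sg ^+ 2 = sg ^+ 4 by ring.
lra.
Qed.

(** * Growth estimates along a line *)

Section SelfConcordantCurves.
Context {R : realType}.
Implicit Types (g dg y : R -> R).

Lemma is_derive_ndecr g dg (a b : R) : a <= b ->
  (forall t : R, a <= t <= b -> is_derive t 1 g (dg t)) ->
  (forall t : R, a <= t <= b -> 0 <= dg t) -> g a <= g b.
Proof.
move=> ab dgP dg0; rewrite -subr_ge0.
have [||c cab ->] := @MVT_segment _ g dg a b ab.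
- by move=> x /subset_itv_oo_cc; rewrite in_itv /= => /dgP.
- apply: derivable_within_continuous => x; rewrite in_itv /= => /dgP H.
  exact: ex_derive.
- by apply: mulr_ge0; [apply: dg0; move: cab; rewrite in_itv | rewrite subr_ge0].
Qed.

(** Along a line, [y] is the second derivative. The bounds say that [y^(-1/2)] changes by at most
    [t] between [0] and [t], in a form that keeps its meaning where [y] vanishes. *)
Lemma sqrt_self_concordant_bounds y dy (t : R) : 0 <= t ->
  (forall s : R, 0 <= s <= t -> is_derive s 1 y (dy s)) ->
  (forall s : R, 0 <= s <= t -> 0 <= y s) ->
  (forall s : R, 0 <= s <= t -> `|dy s| <= 2 * (y s * Num.sqrt (y s))) ->
  Num.sqrt (y 0) / (1 + t * Num.sqrt (y 0)) <= Num.sqrt (y t) /\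
  Num.sqrt (y t) / (1 + t * Num.sqrt (y t)) <= Num.sqrt (y 0).
Proof.
move=> t0 dyP y0 sc.
(* Wherever [y] is positive, [(y^(-1/2))'] has absolute value at most 1; adding
   [e > 0] to [y] gives positivity and keeps the hypotheses. *)
have key e : 0 < e -> `|(Num.sqrt (y t + e))^-1 - (Num.sqrt (y 0 + e))^-1| <= t.
  move=> e0.
  pose z s := (Num.sqrt (y s + e))^-1.
  pose dz s := - (Num.sqrt (y s + e)) ^- 2 * ((2 * Num.sqrt (y s + e))^-1 * dy s).
  have w0 s : 0 <= s <= t -> 0 < y s + e by move=> /y0 ?; rewrite ltr_wpDl.
  have dzP s : 0 <= s <= t -> is_derive s 1 z (dz s).
    move=> st; have ? := dyP _ st; have ws := w0 _ st.
    have d1 : is_derive s 1 (fun s => y s + e) (dy s).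
      by apply: is_derive_eq; rewrite addr0.
    have d2 : is_derive s 1 (fun s => Num.sqrt (y s + e))
        ((2 * Num.sqrt (y s + e))^-1 * dy s).
      rewrite mulrC; have := @is_derive1_comp _ Num.sqrt (fun s => y s + e) s _ _
        (is_derive1_sqrt ws) d1; by rewrite /comp mulrC.
    have n0 : Num.sqrt (y s + e) != 0 by rewrite gt_eqF// sqrtr_gt0.
    exact: (@is_deriveV R (fun s => Num.sqrt (y s + e)) _ _ _ n0 d2).
  have dz1 s : 0 <= s <= t -> `|dz s| <= 1.
    move=> st; have ws := w0 _ st; have ys := y0 _ st.
    set p := Num.sqrt (y s + e).
    have p0 : 0 < p by rewrite sqrtr_gt0.
    have pE : p ^+ 2 = y s + e by rewrite sqr_sqrtr// ltW.
    rewrite /dz -/p normrM normrN !normrM !normfV normrX normrM.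
    rewrite (gtr0_norm p0) (gtr0_norm (_ : 0 < 2 :> R))//.
    have qp : Num.sqrt (y s) <= p by apply: ler_wsqrtr; rewrite lerDl ltW.
    have : `|dy s| <= 2 * (p ^+ 2 * p).
      apply: le_trans (sc _ st) _; rewrite ler_pM2l//.
      by apply: ler_pM; rewrite ?sqrtr_ge0// pE lerDl ltW.
    move=> h; set a := `|dy s|.
    have -> : p ^- 2 * ((2 * p)^-1 * a) = a / (2 * (p ^+ 2 * p)).
      by field; rewrite gt_eqF.
    by rewrite ler_pdivrMr ?mul1r// ?mulr_gt0 ?exprn_gt0.
  have lo : z 0 - 0 <= z t + t.
    rewrite subr0 -[z 0]addr0.
    apply: (@is_derive_ndecr (fun s => z s + s) (fun s => dz s + 1)) => // s st.
      by have ? := dzP _ st; apply: is_derive_eq.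
    by have := dz1 _ st; rewrite ler_norml => /andP[]; lra.
  have hi : 0 - z 0 <= t - z t.
    apply: (@is_derive_ndecr (fun s => s - z s) (fun s => 1 - dz s)) => // s st.
      by have ? := dzP _ st; apply: is_derive_eq.
    by have := dz1 _ st; rewrite ler_norml => /andP[]; lra.
  by rewrite ler_norml -/(z t) -/(z 0); apply/andP; split; lra.
have y00 : 0 <= y 0 by apply: y0; rewrite lexx.
have yt0 : 0 <= y t by apply: y0; rewrite lexx t0.
(* Both bounds are this one, with the roles of [y 0] and [y t] exchanged. *)
have main (a b : R) : 0 <= a -> 0 <= b ->
    (forall e, 0 < e -> (Num.sqrt (b + e))^-1 - (Num.sqrt (a + e))^-1 <= t) ->
    Num.sqrt a / (1 + t * Num.sqrt a) <= Num.sqrt b.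
  move=> a0 b0 H.
  set u := Num.sqrt a / _.
  have u0 : 0 <= u by rewrite divr_ge0 ?sqrtr_ge0// addr_ge0// mulr_ge0// sqrtr_ge0.
  suff : u ^+ 2 <= b.
    by move=> /ler_wsqrtr; rewrite sqrtr_sqr ger0_norm.
  apply/ler_addgt0Pr => e e0.
  set p := Num.sqrt (b + e).
  have p0 : 0 < p by rewrite sqrtr_gt0 ltr_wpDl.
  have -> : b + e = p ^+ 2 by rewrite sqr_sqrtr// addr_ge0// ltW.
  rewrite ler_sqr ?nnegrE// ?(ltW p0)//.
  have {H} := H _ e0; rewrite -/p; set q := Num.sqrt (a + e).
  have q0 : 0 < q by rewrite sqrtr_gt0 ltr_wpDl.
  have aq : Num.sqrt a <= q by apply: ler_wsqrtr; rewrite lerDl ltW.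
  move=> H.
  have H2 : q <= p * (1 + t * q).
    have : (p^-1 - q^-1) * (p * q) <= t * (p * q) by rewrite ler_pM2r// mulr_gt0.
    have -> : (p^-1 - q^-1) * (p * q) = q - p by field; rewrite !gt_eqF.
    lra.
  have a0' := sqrtr_ge0 a; set s := Num.sqrt a in aq a0' u u0 *.
  rewrite /u ler_pdivrMr; last by rewrite ltr_wpDr// mulr_ge0.
  (* [H2] reads [q * (1 - t * p) <= p]. If the factor is nonnegative, [q] may be lowered to [s];
     otherwise [p] exceeds [1 / t], which bounds [s / (1 + t * s)]. *)
  have [h|h] := leP (t * p) 1; last by nra.
  have : s * (1 - t * p) <= q * (1 - t * p) by rewrite ler_wpM2r// subr_ge0.
  nra.
split; apply: main => // e e0; have := key _ e0; rewrite ler_norml => /andP[]; lra.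
Qed.

(** This quotient is a rational substitute for the logarithmic remainder of self-concordance, with
    [c = r] in the lower bound and [c = - r] in the upper one. *)
Lemma is_derive_half_sqr_over (c t : R) : 1 + c * t != 0 ->
  is_derive t 1 (fun s => s ^+ 2 / (2 * (1 + c * s)))
                (t * (2 + c * t) / (2 * (1 + c * t) ^+ 2)).
Proof.
move=> nz.
have n2 : 2 * (1 + c * t) != 0 by rewrite mulf_neq0.
have d1 : is_derive t 1 (fun s => 2 * (1 + c * s)) (2 * c).
  apply: is_derive_eq; rewrite /GRing.scale /=; ring.
have d2 := @is_deriveV _ (fun s => 2 * (1 + c * s)) _ _ _ n2 d1.
apply: is_derive_eq; rewrite /GRing.scale /=; by field.
Qed.

Lemma is_derive_over (c t : R) : 1 + c * t != 0 ->
  is_derive t 1 (fun s => s / (1 + c * s)) ((1 + c * t) ^- 2).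
Proof.
move=> nz.
have d1 : is_derive t 1 (fun s => 1 + c * s) c.
  apply: is_derive_eq; rewrite /GRing.scale /=; ring.
have d2 := @is_deriveV _ (fun s => 1 + c * s) _ _ _ nz d1.
apply: is_derive_eq; rewrite /GRing.scale /=; by field.
Qed.

Section Curve.
Variables phi phi1 phi2 phi3 : R -> R.
Hypothesis d0 : forall s : R, 0 <= s <= 1 -> is_derive s 1 phi (phi1 s).
Hypothesis d1 : forall s : R, 0 <= s <= 1 -> is_derive s 1 phi1 (phi2 s).
Hypothesis d2 : forall s : R, 0 <= s <= 1 -> is_derive s 1 phi2 (phi3 s).
Hypothesis phi2_ge0 : forall s : R, 0 <= s <= 1 -> 0 <= phi2 s.
Hypothesis phi3_le : forall s : R, 0 <= s <= 1 ->
  `|phi3 s| <= 2 * (phi2 s * Num.sqrt (phi2 s)).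

Let r := Num.sqrt (phi2 0).
Let r_ge0 : 0 <= r. Proof. exact: sqrtr_ge0. Qed.

Let bounds t : 0 <= t <= 1 ->
  r / (1 + t * r) <= Num.sqrt (phi2 t) /\
  Num.sqrt (phi2 t) / (1 + t * Num.sqrt (phi2 t)) <= r.
Proof.
move=> /andP[t0 t1].
have st s : 0 <= s <= t -> 0 <= s <= 1.
  by move=> /andP[-> /le_trans]; apply.
by apply: (@sqrt_self_concordant_bounds phi2 phi3) => // s /st;
  [exact: d2|exact: phi2_ge0|exact: phi3_le].
Qed.

Let den t : 0 <= t <= 1 -> 0 < 1 + r * t.
Proof. by move=> /andP[t0 _]; rewrite ltr_wpDr// mulr_ge0. Qed.

Let phi2_lower t : 0 <= t <= 1 -> r ^+ 2 * (1 + r * t) ^- 2 <= phi2 t.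
Proof.
move=> t01; have [+ _] := bounds t01.
rewrite [t * r]mulrC => h.
rewrite -exprVn -exprMn -(sqr_sqrtr (phi2_ge0 t01)).
by rewrite ler_sqr ?nnegrE ?sqrtr_ge0// divr_ge0// ltW// den.
Qed.

Let phi2_upper t : r < 1 -> 0 <= t <= 1 -> phi2 t <= r ^+ 2 * (1 + - r * t) ^- 2.
Proof.
move=> r1 t01; have [_] := bounds t01.
have t0 : 0 <= t by case/andP: t01.
have p : 0 < 1 + - r * t.
  case/andP: t01 => _ t1; have := ler_piMr r_ge0 t1; lra.
set s := Num.sqrt _; have s0 : 0 <= s by exact: sqrtr_ge0.
rewrite ler_pdivrMr; last by rewrite ltr_wpDr// mulr_ge0.
move=> h; rewrite -exprVn -exprMn -(sqr_sqrtr (phi2_ge0 t01)) -/s.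
have q0 : 0 <= r / (1 + - r * t) by rewrite divr_ge0// ltW.
by rewrite ler_sqr ?nnegrE// ler_pdivlMr//; lra.
Qed.

(** Integrates [phi2_lower]: [t / (1 + r * t)] is a primitive of [(1 + r * t) ^- 2]. *)
Lemma curve_slope_lower t : 0 <= t <= 1 ->
  r ^+ 2 * (t / (1 + r * t)) <= phi1 t - phi1 0.
Proof.
move=> /andP[t0 t1].
have st s : 0 <= s <= t -> 0 <= s <= 1 by move=> /andP[-> /le_trans]; apply.
pose g s := phi1 s - phi1 0 - r ^+ 2 * (s / (1 + r * s)).
suff : g 0 <= g t by rewrite /g mul0r mulr0; lra.
apply: (@is_derive_ndecr g (fun s => phi2 s - r ^+ 2 * (1 + r * s) ^- 2)) => // s /st s01.
  have ? := d1 s01; have ? := is_derive_over (lt0r_neq0 (den s01)).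
  by apply: is_derive_eq; rewrite /GRing.scale /=; ring.
by rewrite subr_ge0 phi2_lower.
Qed.

(** Integrates the slope bound: the derivative of the rational remainder stays below
    [r ^+ 2 * (s / (1 + r * s))] because [2 + r * s <= 2 * (1 + r * s)]. *)
Lemma curve_lower : r ^+ 2 / (2 * (1 + r)) <= phi 1 - phi 0 - phi1 0.
Proof.
pose g s := phi s - phi1 0 * s - r ^+ 2 * (s ^+ 2 / (2 * (1 + r * s))).
suff : g 0 <= g 1 by rewrite /g !mulr0 expr0n mul0r mulr0 !mulr1 expr1n; lra.
apply: (@is_derive_ndecr g (fun s => phi1 s - phi1 0
   - r ^+ 2 * (s * (2 + r * s) / (2 * (1 + r * s) ^+ 2)))) => // s s01.
  have ? := d0 s01; have ? := is_derive_half_sqr_over (lt0r_neq0 (den s01)).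
  by apply: is_derive_eq; rewrite /GRing.scale /=; ring.
rewrite subr_ge0; apply: le_trans (curve_slope_lower s01).
apply: ler_wpM2l; first exact: sqr_ge0.
have s0 : 0 <= s by case/andP: s01.
have := den s01; set w := 1 + r * s => w0.
rewrite ler_pdivrMr ?mulr_gt0 ?exprn_gt0//.
have -> : s / w * (2 * w ^+ 2) = s * (2 * w) by field; rewrite gt_eqF.
by apply: ler_wpM2l => //; rewrite /w; have := mulr_ge0 r_ge0 s0; lra.
Qed.

(** The same two integrations with [- r] for [r] and the inequalities reversed; [r < 1] keeps the
    denominators positive. *)
Lemma curve_upper : r < 1 -> forall t : R, 0 <= t <= 1 ->
  phi t - phi 0 - t * phi1 0 <= r ^+ 2 * (t ^+ 2 / (2 * (1 - r * t))).
Proof.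
move=> r1 t /andP[t0 t1].
have st s : 0 <= s <= t -> 0 <= s <= 1 by move=> /andP[-> /le_trans]; apply.
have p s : 0 <= s <= 1 -> 0 < 1 + - r * s.
  by move=> /andP[_ s1]; have := ler_piMr r_ge0 s1; lra.
have slope s : 0 <= s <= 1 -> phi1 s - phi1 0 <= r ^+ 2 * (s / (1 + - r * s)).
  move=> /andP[s0 s1].
  pose g s := r ^+ 2 * (s / (1 + - r * s)) - (phi1 s - phi1 0).
  suff : g 0 <= g s by rewrite /g mul0r mulr0; lra.
  apply: (@is_derive_ndecr g (fun s => r ^+ 2 * (1 + - r * s) ^- 2 - phi2 s)) => // x xs.
    have x01 : 0 <= x <= 1 by case/andP: xs => -> /le_trans; apply.
    have ? := d1 x01; have ? := is_derive_over (lt0r_neq0 (p _ x01)).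
    by apply: is_derive_eq; rewrite /GRing.scale /=; ring.
  by rewrite subr_ge0 phi2_upper//; case/andP: xs => -> /le_trans; apply.
pose g s := r ^+ 2 * (s ^+ 2 / (2 * (1 + - r * s))) - (phi s - phi1 0 * s).
suff : g 0 <= g t.
  by rewrite /g !mulr0 expr0n mul0r mulr0 mulNr; lra.
apply: (@is_derive_ndecr g (fun s => r ^+ 2 * (s * (2 + - r * s) / (2 * (1 + - r * s) ^+ 2))
   - (phi1 s - phi1 0))) => // s /st s01.
  have ? := d0 s01; have ? := is_derive_half_sqr_over (lt0r_neq0 (p _ s01)).
  by apply: is_derive_eq; rewrite /GRing.scale /=; ring.
rewrite subr_ge0; apply: le_trans (slope _ s01) _.
apply: ler_wpM2l; first exact: sqr_ge0.
have s0 : 0 <= s by case/andP: s01.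
have := p _ s01; set w := 1 + - r * s => w0.
rewrite ler_pdivlMr ?mulr_gt0 ?exprn_gt0//.
have -> : s / w * (2 * w ^+ 2) = s * (2 * w) by field; rewrite gt_eqF.
by apply: ler_wpM2l => //; rewrite /w; have := mulr_ge0 r_ge0 s0; lra.
Qed.

End Curve.

End SelfConcordantCurves.

(** * Linear functionals on subspaces of matrices *)

Section DotProduct.
Context {R : realType} {m n : nat}.
Local Notation E := 'M[R]_(m, n).
Implicit Types (g h k : E) (L : set E).

Lemma dotpC g h : dotp g h = dotp h g.
Proof. by apply: eq_bigr => i _; apply: eq_bigr => j _; rewrite mulrC. Qed.

Lemma dotpDr g h k : dotp g (h + k) = dotp g h + dotp g k.
Proof.
rewrite -big_split; apply: eq_bigr => i _; rewrite -big_split.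
by apply: eq_bigr => j _; rewrite mxE mulrDr.
Qed.

Lemma dotpZr g a h : dotp g (a *: h) = a * dotp g h.
Proof.
rewrite mulr_sumr; apply: eq_bigr => i _; rewrite mulr_sumr.
by apply: eq_bigr => j _; rewrite mxE mulrCA.
Qed.

Lemma dotpDl g h k : dotp (g + h) k = dotp g k + dotp h k.
Proof. by rewrite dotpC dotpDr !(dotpC k). Qed.

Lemma dotpZl a g h : dotp (a *: g) h = a * dotp g h.
Proof. by rewrite dotpC dotpZr dotpC. Qed.

Lemma dotpNr g h : dotp g (- h) = - dotp g h.
Proof. by rewrite -scaleN1r dotpZr mulN1r. Qed.

Lemma dotpNl g h : dotp (- g) h = - dotp g h.
Proof. by rewrite dotpC dotpNr dotpC. Qed.

Lemma dotpBr g h k : dotp g (h - k) = dotp g h - dotp g k.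
Proof. by rewrite dotpDr dotpNr. Qed.

Lemma dotpBl g h k : dotp (g - h) k = dotp g k - dotp h k.
Proof. by rewrite dotpDl dotpNl. Qed.

Lemma dotp0r g : dotp g 0 = 0.
Proof. by rewrite -(scale0r g) dotpZr mul0r. Qed.

Lemma dotp_sumr g I (s : seq I) (P : pred I) (h : I -> E) :
  dotp g (\sum_(i <- s | P i) h i) = \sum_(i <- s | P i) dotp g (h i).
Proof. exact: (@big_morph _ _ _ 0 +%R _ _ (dotpDr g) (dotp0r g)). Qed.

Lemma dotp_suml g I (s : seq I) (P : pred I) (h : I -> E) :
  dotp (\sum_(i <- s | P i) h i) g = \sum_(i <- s | P i) dotp (h i) g.
Proof. by rewrite dotpC dotp_sumr; apply: eq_bigr => i _; rewrite dotpC. Qed.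

Lemma dotp_eq0 g : dotp g g = 0 -> g = 0.
Proof.
have sq i : 0 <= \sum_j g i j * g i j.
  by apply: sumr_ge0 => j _; rewrite -expr2 sqr_ge0.
move=> /eqP; rewrite psumr_eq0; last by move=> i _; exact: sq.
move=> /allP H; apply/matrixP => i j; rewrite mxE; apply/eqP.
have := H i; rewrite mem_index_enum => /(_ isT) /=.
rewrite psumr_eq0; last by move=> j' _; rewrite -expr2 sqr_ge0.
by move=> /allP/(_ j); rewrite mem_index_enum /= mulf_eq0 orbb => /(_ isT).
Qed.

Lemma dotp_inj g h : (forall k, dotp g k = dotp h k) -> g = h.
Proof. by move=> H; apply/subr0_eq/dotp_eq0; rewrite dotpBl H subrr. Qed.

Definition subspace L := L 0 /\ forall a u v, L u -> L v -> L (a *: u + v).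

(** A vector space of maximal dimension inside [L] must contain all of [L]. On a basis of it, the
    coefficients of [g] solve a linear system whose matrix is the Gram matrix. *)
Lemma subspace_representation L (l : E -> R) : subspace L ->
  (forall a u v, L u -> L v -> l (a *: u + v) = a * l u + l v) ->
  exists2 g, L g & forall k, L k -> l k = dotp g k.
Proof.
move=> [L0 Llin] llin.
pose P d := `[< exists2 V : {vspace E}, (forall k, k \in V -> L k) & \dim V = d >].
have exP : exists d, P d.
  exists 0%N; apply/asboolP; exists 0%VS; last by rewrite dimv0.
  by move=> k; rewrite memv0 => /eqP ->.
have [|d /asboolP[V VL dV] dmax] := @ex_maxnP P (\dim {:E}) exP.
  by move=> d /asboolP[V _ <-]; apply/dimvS/subvf.
have LV k : L k -> k \in V.
  move=> Lk; apply: contraT => kV.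
  have : P (\dim (V + <[k]>)).
    apply/asboolP; exists (V + <[k]>)%VS => // _ /memv_addP[v /VL Lv [_ /vlineP[a ->] ->]].
    by rewrite addrC; exact: Llin.
  move=> /dmax; rewrite -dV => le_dim.
  have : (V == V + <[k]>)%VS by rewrite eqEdim addvSl.
  move=> /eqP VE; move: kV; rewrite VE.
  by rewrite -{1}[k]add0r memv_add ?mem0v// memv_line.
pose b := vbasis V.
have bL i : L b`_i.
  have [ib|ib] := ltnP i (\dim V); last by rewrite nth_default// size_tuple.
  by apply: VL; apply: vbasis_mem; apply: mem_nth; rewrite size_tuple.
have lsum (c : 'I_(\dim V) -> R) s : L (\sum_(i <- s) c i *: b`_i) /\
    l (\sum_(i <- s) c i *: b`_i) = \sum_(i <- s) c i * l b`_i.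
  elim: s => [|i s [IH1 IH2]]; last by rewrite !big_cons llin// IH2; split=> //; exact: Llin.
  rewrite !big_nil; split; first exact: L0.
  by have := llin (-1) 0 0 L0 L0; rewrite scaler0 addr0 mulN1r addNr.
pose G := \matrix_(i < \dim V, j < \dim V) dotp b`_i b`_j.
(* A combination [w] of the basis whose coefficients are killed by [G] is orthogonal to itself. *)
have Gunit : G \in unitmx.
  rewrite -row_free_unit; apply/inj_row_free => u uG.
  pose w := \sum_i u 0 i *: b`_i.
  have : dotp w w = 0.
    rewrite /w dotp_sumr big1// => j _; rewrite dotpZr dotp_suml.
    have -> : \sum_i dotp (u 0 i *: b`_i) b`_j = (u *m G) 0 j.
      by rewrite [RHS]mxE; apply: eq_bigr => i _; rewrite dotpZl [G _ _]mxE.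
    by rewrite uG mxE mulr0.
  move=> /dotp_eq0 w0; apply/rowP => i; rewrite mxE.
  have := coord_sum_free (fun i => u 0 i) i (basis_free (vbasisP V)).
  by rewrite -/w w0 linear0.
pose u := (\row_j l b`_j) *m invmx G.
exists (\sum_i u 0 i *: b`_i); first by case: (lsum (fun i => u 0 i) (index_enum _)).
move=> k /LV kV; rewrite (coord_vbasis kV) dotp_sumr.
rewrite (lsum (fun i => coord (vbasis V) i k) _).2; apply: eq_bigr => j _.
rewrite dotpZr dotp_suml; congr (_ * _).
have -> : \sum_i dotp (u 0 i *: b`_i) b`_j = (u *m G) 0 j.
  by rewrite [RHS]mxE; apply: eq_bigr => i _; rewrite dotpZl [G _ _]mxE.
by rewrite mulmxKV// mxE.
Qed.

End DotProduct.

(** * Self-concordant barriers on a relative interior *)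

Section MirrorBarrier.
Context {R : realType} {m n : nat}.
Local Notation E := 'M[R]_(m, n).
Variables (C : set E) (F : E -> R).
Hypothesis convexC : forall v w (t : R), C v -> C w -> 0 <= t <= 1 ->
  C (v + t *: (w - v)).
Hypothesis boundedC : forall f, exists M, forall v, C v -> `|dotp f v| <= M.
Hypothesis barrierF : mirror_barrier C F.
Implicit Types (v w h k f g : E) (s t a e : R) (H : E -> R).

Local Notation L := (direction C).
Local Notation S := (relint C).
Local Notation G := (grad L F).
Local Notation N v k := ('D_k ('D_k F) v).

Lemma direction_subspace : subspace L.
Proof.
split; first by exists 0%N, (fun=> 0), (fun=> 0), (fun=> 0); split=> [[]//|]; rewrite big_ord0.
move=> a _ _ [p [c [v [w [Cvw ->]]]]] [p' [c' [v' [w' [Cvw' ->]]]]].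
pose sel T (x : 'I_p -> T) (x' : 'I_p' -> T) (i : 'I_(p + p')) :=
  match fintype.split i with inl j => x j | inr j => x' j end.
exists (p + p')%N, (sel _ (fun i => a * c i) c'), (sel _ v v'), (sel _ w w').
split; first by move=> i; rewrite /sel; case: fintype.split.
rewrite big_split_ord /= scaler_sumr; congr (_ + _); apply: eq_bigr => i _.
  by rewrite /sel; have -> := unsplitK (inl i : 'I_p + 'I_p'); rewrite scalerA.
by rewrite /sel; have -> := unsplitK (inr i : 'I_p + 'I_p').
Qed.

Lemma direction0 : L 0. Proof. by case: direction_subspace. Qed.

Lemma directionZ a h : L h -> L (a *: h).
Proof.
by move=> Lh; rewrite -[_ *: _]addr0; apply: direction_subspace.2 => //; exact: direction0.
Qed.

Lemma directionD h k : L h -> L k -> L (h + k).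
Proof. by move=> Lh Lk; rewrite -[h]scale1r; exact: direction_subspace.2. Qed.

Lemma direction_sub v w : C v -> C w -> L (v - w).
Proof.
move=> Cv Cw; exists 1%N, (fun=> 1), (fun=> v), (fun=> w); split=> //.
by rewrite big_ord1 scale1r.
Qed.

Lemma relint_sub v : S v -> C v. Proof. by case. Qed.

Lemma relint_direction v w : S v -> S w -> L (w - v).
Proof. by move=> [Cv _] [Cw _]; exact: direction_sub. Qed.

(** [relint] only asks for a neighbourhood inside [C]; halving its radius places it inside [S]
    itself. *)
Lemma relint_open v : S v ->
  exists2 d, 0 < d & forall h, L h -> `|h| < d -> S (v + h).
Proof.
move=> [Cv /nbhs_normP[d /= d0 Hd]]; have d20 : 0 < d / 2 by rewrite divr_gt0.
have Cd h : `|h| < d -> L h -> C (v + h).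
  by move=> hd Lh; apply: Hd => //=; rewrite sub0r normrN.
exists (d / 2) => // h Lh hd; split; first by apply: Cd => //; lra.
apply/nbhs_normP; exists (d / 2) => //= k /=; rewrite sub0r normrN => kd Lk.
rewrite -addrA; apply: Cd; last exact: directionD.
by apply: le_lt_trans (ler_normD _ _) _; lra.
Qed.

Lemma relint_open_line v h : S v -> L h ->
  exists2 d, 0 < d & forall t, `|t| < d -> S (v + t *: h).
Proof.
move=> /relint_open[d d0 Sd] Lh.
have h1 : 0 < `|h| + 1 by rewrite ltr_wpDl.
exists (d / (`|h| + 1)); first exact: divr_gt0.
move=> t td; apply: Sd; first exact: directionZ.
rewrite normrZ; apply: le_lt_trans (_ : `|t| * (`|h| + 1) < d); last by rewrite -ltr_pdivlMr.
by rewrite ler_wpM2l// lerDl.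
Qed.

Lemma relint_segment v w t : S v -> S w -> 0 <= t <= 1 -> S (v + t *: (w - v)).
Proof.
move=> [Cv nv] [Cw nw] t01; split; first exact: convexC.
apply: filterS2 nv nw => h vh wh Lh.
have -> : v + t *: (w - v) + h = (v + h) + t *: ((w + h) - (v + h)).
  by apply/matrixP => i j; rewrite !mxE; ring.
by apply: convexC => //; [exact: vh|exact: wh].
Qed.

Lemma convexF v w t : S v -> S w -> 0 <= t <= 1 ->
  F (v + t *: (w - v)) <= F v + t * (F w - F v).
Proof.
move=> Sv Sw /andP[t0 t1]; have [cvxF _ _] := mb_self_concordant barrierF.
have u0 : 0 <= 1 - t by rewrite subr_ge0.
have u1 : 1 - t <= 1 by rewrite gerBl.
have := cvxF (Itv01 u0 u1) v w (mem_set Sv) (mem_set Sw).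
rewrite convRE /= => H.
have -> : v + t *: (w - v) = (1 - t) *: v + (1 - (1 - t)) *: w.
  by apply/matrixP => i j; rewrite !mxE; ring.
apply: le_trans H _; rewrite /unstable.onem; lra.
Qed.

Lemma derivable_relint h v : L h -> S v ->
  [/\ derivable F v h, derivable ('D_h F) v h & derivable ('D_h ('D_h F)) v h].
Proof.
move=> Lh Sv; have [_ ckF _] := mb_self_concordant barrierF.
have [_ /(_ h Lh)[d0 [_ /(_ h Lh)[d1 [_ /(_ h Lh)[d2 _]]]]]] := ckF.
by split; [exact: d0|exact: d1|exact: d2].
Qed.

Lemma eq_derive_relint H1 H2 h v l : {in S, H1 =1 H2} -> L h -> S v ->
  is_derive v h H1 l -> is_derive v h H2 l.
Proof.
move=> E Lh Sv; apply: eq_is_derive; have [d d0 Sd] := relint_open_line Sv Lh.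
by exists d => // t /Sd ?; apply: E; rewrite inE.
Qed.

Lemma derive_scale H h a v : derivable H v h -> 'D_(a *: h) H v = a * 'D_h H v.
Proof. by move=> d; apply: derive_val; apply: is_derive_scale; exact: derivableP. Qed.

(** [N v k] is an iterated directional derivative, so its homogeneity is proved by extracting [a]
    twice; the inner identity holds on [S] only. *)
Lemma hessian_scale v k a : L k -> S v -> N v (a *: k) = a ^+ 2 * N v k.
Proof.
move=> Lk Sv; have [_ d1 _] := derivable_relint Lk Sv.
apply: derive_val; rewrite expr2 -mulrA.
suff d : is_derive v k ('D_(a *: k) F) (a * N v k) by exact: is_derive_scale a d.
have E : {in S, (a *: 'D_k F) =1 'D_(a *: k) F}.
  move=> w; rewrite inE => Sw; have [d0 _ _] := derivable_relint Lk Sw.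
  by rewrite (derive_scale a d0).
exact: (eq_derive_relint E Lk Sv (is_deriveZ a (derivableP d1))).
Qed.

Lemma third_derive_opp v k : L k -> S v ->
  'D_(- k) ('D_(- k) ('D_(- k) F)) v = - 'D_k ('D_k ('D_k F)) v.
Proof.
move=> Lk Sv; have [_ _ d2] := derivable_relint Lk Sv.
suff d : is_derive v k ('D_(- k) ('D_(- k) F)) ('D_k ('D_k ('D_k F)) v).
  by have := is_derive_scale (-1) d; rewrite scaleN1r mulN1r => ?; exact: derive_val.
have E : {in S, 'D_k ('D_k F) =1 'D_(- k) ('D_(- k) F)}.
  move=> w; rewrite inE => Sw; have := hessian_scale (-1) Lk Sw.
  by rewrite scaleN1r sqrrN expr1n mul1r => ->.
exact: (eq_derive_relint E Lk Sv (derivableP d2)).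
Qed.

(** The point [v + t *: (h + k)] is the midpoint of [v + (2 * t) *: h] and [v + (2 * t) *: k]:
    convexity there, divided by [t], gives the claim as [t] tends to 0. *)
Lemma is_derive_subadditive v h k (lh lk lhk : R) : L h -> L k -> S v ->
  is_derive v h F lh -> is_derive v k F lk -> is_derive v (h + k) F lhk ->
  lhk <= lh + lk.
Proof.
move=> Lh Lk Sv /is_deriveP dh /is_deriveP dk /is_deriveP dhk.
apply/ler_addgt0Pr => e e0; have e30 : 0 < e / 3 by rewrite divr_gt0.
have [a1 a10 {}dh] := dh _ e30; have [a2 a20 {}dk] := dk _ e30.
have [a3 a30 {}dhk] := dhk _ e30.
have [a4 a40 Sh] := relint_open_line Sv Lh; have [a5 a50 Sk] := relint_open_line Sv Lk.
pose M := Num.min (Num.min a1 a2) (Num.min a3 (Num.min a4 a5)).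
have M0 : 0 < M by rewrite !lt_min a10 a20 a30 a40 a50.
have [t t0 lt4] : exists2 t, 0 < t & forall a, M <= a -> `|2 * t| < a.
  exists (M / 4); first exact: divr_gt0.
  move=> a; apply: lt_le_trans; rewrite gtr0_norm; last by rewrite mulr_gt0// divr_gt0.
  by lra.
have t1 : `|2 * t| < a1 by apply: lt4; rewrite !ge_min lexx.
have t2 : `|2 * t| < a2 by apply: lt4; rewrite !ge_min lexx !orbT.
have t3 : `|2 * t| < a3 by apply: lt4; rewrite !ge_min lexx !orbT.
have t4 : `|2 * t| < a4 by apply: lt4; rewrite !ge_min lexx !orbT.
have t5 : `|2 * t| < a5 by apply: lt4; rewrite !ge_min lexx !orbT.
have t3' : `|t| < a3 by apply: le_lt_trans t3; rewrite normrM ler_peMl// ger0_norm ?ler1n.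
have half : 0 <= (2^-1 : R) <= 1 by rewrite invr_ge0 ler0n invf_le1// ler1n.
have := convexF (Sh _ t4) (Sk _ t5) half.
have -> : v + (2 * t) *: h + 2^-1 *: (v + (2 * t) *: k - (v + (2 * t) *: h)) = v + t *: (h + k).
  apply/matrixP => i j; rewrite !mxE; by field.
have := dh _ t1; have := dk _ t2; have := dhk _ t3'.
have t20 : 0 < 2 * t by rewrite mulr_gt0.
rewrite !ler_norml (gtr0_norm t0) (gtr0_norm t20) => /andP[h1 _] /andP[_ h2] /andP[_ h3] h4.
by rewrite -(ler_pM2l t0); lra.
Qed.

Lemma derive_subadditive v h k : L h -> L k -> S v ->
  'D_(h + k) F v <= 'D_h F v + 'D_k F v.
Proof.
move=> Lh Lk Sv; have Lhk := directionD Lh Lk.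
have [/derivableP dh _ _] := derivable_relint Lh Sv.
have [/derivableP dk _ _] := derivable_relint Lk Sv.
have [/derivableP dhk _ _] := derivable_relint Lhk Sv.
exact: is_derive_subadditive dh dk dhk.
Qed.

(** Subadditivity applied to [h, k] and to [- h, - k] makes the directional derivative additive; its
    representing vector in [L] shows that the [get] in [grad] has a witness. *)
Lemma gradP v : S v -> L (G v) /\ forall h, L h -> is_derive v h F (dotp (G v) h).
Proof.
move=> Sv.
have dN h : L h -> 'D_(- h) F v = - 'D_h F v.
  by move=> Lh; rewrite -scaleN1r derive_scale ?mulN1r//; case: (derivable_relint Lh Sv).
have dD h k : L h -> L k -> 'D_(h + k) F v = 'D_h F v + 'D_k F v.
  move=> Lh Lk; apply/eqP; rewrite eq_le derive_subadditive//=.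
  have LN x : L x -> L (- x) by move=> /(directionZ (-1)); rewrite scaleN1r.
  rewrite -lerN2 opprD -(dN _ Lh) -(dN _ Lk) -(dN _ (directionD Lh Lk)) opprD.
  exact: derive_subadditive (LN _ Lh) (LN _ Lk) Sv.
have [|g Lg gP] := @subspace_representation _ _ _ L (fun h => 'D_h F v) direction_subspace.
  move=> a h k Lh Lk; rewrite dD ?derive_scale//; last exact: directionZ.
  by case: (derivable_relint Lh Sv).
apply: (@getPex _ [set g | L g /\ forall h, L h -> is_derive v h F (dotp g h)]).
exists g; split=> // h Lh; rewrite -gP//; apply: derivableP.
by case: (derivable_relint Lh Sv).
Qed.

Lemma derive_grad v k : L k -> S v -> 'D_k F v = dotp (G v) k.
Proof. by move=> Lk Sv; apply: derive_val; case: (gradP Sv) => _; apply. Qed.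

Lemma grad_le v w : S v -> S w -> dotp (G v) (w - v) <= F w - F v.
Proof.
move=> Sv Sw; apply/ler_addgt0Pr => e e0.
have [_ /(_ _ (relint_direction Sv Sw))/is_deriveP/(_ _ e0)[d d0 H]] := gradP Sv.
pose t := Num.min (d / 2) 1.
have t0 : 0 < t by rewrite lt_min divr_gt0 /=.
have td : `|t| < d by rewrite gtr0_norm// gt_min; apply/orP; left; lra.
have t1 : 0 <= t <= 1 by rewrite ltW//= ge_min lexx orbT.
have := H _ td; have := convexF Sv Sw t1.
rewrite ler_norml (gtr0_norm t0) => h1 /andP[h2 _].
rewrite -(ler_pM2l t0); lra.
Qed.

Lemma bregman_ge0 v w : S v -> S w -> 0 <= bregman C F v w.
Proof. by move=> Sv Sw; rewrite /bregman; have := grad_le Sw Sv; lra. Qed.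

(** Adding the tangent inequalities at [v] and [v + t *: k] shows that the derivative along [k] does
    not decrease, so its difference quotients are nonnegative. *)
Lemma hessian_ge0 v k : L k -> S v -> 0 <= N v k.
Proof.
move=> Lk Sv; rewrite -[_ <= _]opprK; apply/ler_addgt0Pr => e e0.
have [_ /derivableP/is_deriveP/(_ _ e0)[d d0 H] _] := derivable_relint Lk Sv.
have [d' d'0 Sd] := relint_open_line Sv Lk.
pose t := Num.min d d' / 2.
have t0 : 0 < t by rewrite divr_gt0// lt_min d0.
have td : `|t| < d.
  by rewrite gtr0_norm//; apply: lt_le_trans (_ : Num.min d d' <= _);
    [move: t0; rewrite /t; lra|rewrite ge_min lexx].
have td' : `|t| < d'.
  by rewrite gtr0_norm//; apply: lt_le_trans (_ : Num.min d d' <= _);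
    [move: t0; rewrite /t; lra|rewrite ge_min lexx orbT].
have St := Sd _ td'; have := H _ td.
rewrite !derive_grad// ler_norml (gtr0_norm t0) => /andP[_ h].
have := grad_le Sv St; have := grad_le St Sv.
rewrite opprD addNKr addrAC subrr add0r dotpNr !dotpZr => h1 h2.
have h3 : dotp (G v) k <= dotp (G (v + t *: k)) k by rewrite -(ler_pM2l t0); lra.
rewrite -(ler_pM2l t0); lra.
Qed.


Lemma hessian_self_concordant v k : L k -> S v ->
  `|'D_k ('D_k ('D_k F)) v| <= 2 * (N v k * Num.sqrt (N v k)).
Proof.
move=> Lk Sv; have [_ _ sc] := mb_self_concordant barrierF.
have LNk : L (- k) by rewrite -scaleN1r; exact: directionZ.
have N0 := hessian_ge0 Lk Sv.
have NN : N v (- k) = N v k.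
  by rewrite -scaleN1r hessian_scale// sqrrN expr1n mul1r.
exact: two_sided_self_concordance (third_derive_opp Lk Sv) NN N0
  (sc _ _ Sv Lk) (sc _ _ Sv LNk).
Qed.

(** * Second-order bounds on a segment of the relative interior *)

Section Segment.
Variables v k : E.
Hypotheses (Sv : S v) (Svk : S (v + k)).

Let Lk : L k.
Proof. by have := relint_direction Sv Svk; rewrite addrAC subrr add0r. Qed.

Let Sline t : 0 <= t <= 1 -> S (v + t *: k).
Proof. by move=> /(relint_segment Sv Svk); rewrite [v + k - v]addrAC subrr add0r. Qed.

Let phi t := F (v + t *: k).
Let phi1 t := dotp (G (v + t *: k)) k.
Let phi2 t := N (v + t *: k) k.
Let phi3 t := 'D_k ('D_k ('D_k F)) (v + t *: k).

Let d0 t : 0 <= t <= 1 -> is_derive t 1 phi (phi1 t).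
Proof.
move=> /Sline St; apply: is_derive_line.
by case: (gradP St) => _; apply.
Qed.

Let d1 t : 0 <= t <= 1 -> is_derive t 1 phi1 (phi2 t).
Proof.
move=> /Sline St; have [_ /derivableP d _] := derivable_relint Lk St.
have d' := is_derive_line d.
apply: (eq_is_derive _ d'); have [e e0 Se] := relint_open_line St Lk.
exists e => // s /Se; rewrite -addrA -scalerDl => Ss.
by rewrite /phi1 [s *: _]mulr1 derive_grad.
Qed.

Let d2 t : 0 <= t <= 1 -> is_derive t 1 phi2 (phi3 t).
Proof.
move=> /Sline St; have [_ _ /derivableP d] := derivable_relint Lk St.
exact: is_derive_line d.
Qed.

Let phi2_ge0 t : 0 <= t <= 1 -> 0 <= phi2 t.
Proof. by move=> /Sline; exact: hessian_ge0. Qed.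

Let phi3_le t : 0 <= t <= 1 -> `|phi3 t| <= 2 * (phi2 t * Num.sqrt (phi2 t)).
Proof. by move=> /Sline; exact: hessian_self_concordant. Qed.

Let r := Num.sqrt (N v k).

Let v0k : v + 0 *: k = v. Proof. by rewrite scale0r addr0. Qed.
Let v1k : v + 1 *: k = v + k. Proof. by rewrite scale1r. Qed.
Let r0 : Num.sqrt (phi2 0) = r. Proof. by rewrite /phi2 v0k. Qed.

Lemma grad_gap_ge : r ^+ 2 / (1 + r) <= dotp (G (v + k)) k - dotp (G v) k.
Proof.
have t1 : 0 <= (1 : R) <= 1 by rewrite ler01 lexx.
have := curve_slope_lower d1 d2 phi2_ge0 phi3_le t1.
by rewrite r0 mulr1 mul1r /phi1 v0k v1k.
Qed.

Lemma bregman_lower : r ^+ 2 / (2 * (1 + r)) <= F (v + k) - F v - dotp (G v) k.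
Proof.
have := curve_lower d0 d1 d2 phi2_ge0 phi3_le.
by rewrite r0 /phi /phi1 v0k v1k.
Qed.

Lemma bregman_upper : r < 1 ->
  F (v + k) - F v - dotp (G v) k <= r ^+ 2 / (2 * (1 - r)).
Proof.
move=> r1; have t1 : 0 <= (1 : R) <= 1 by rewrite ler01 lexx.
have := curve_upper d0 d1 d2 phi2_ge0 phi3_le.
rewrite r0 => /(_ r1 _ t1); rewrite mul1r mulr1 expr1n mul1r.
by rewrite /phi /phi1 v0k v1k.
Qed.

End Segment.

(* The Dikin ellipsoid: on a segment leaving the domain within it, F would stay bounded. *)
Lemma dikin v k : S v -> L k -> N v k < 1 -> S (v + k).
Proof.
move=> Sv Lk Nk.
have [r [r0 r1 rE]] : exists r : R, [/\ 0 <= r, r < 1 &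
    forall t, 0 <= t -> Num.sqrt (N v (t *: k)) = t * r].
  exists (Num.sqrt (N v k)); split; first exact: sqrtr_ge0.
    by rewrite -[X in _ < X]sqrtr1 ltr_sqrt.
  by move=> t t0; rewrite hessian_scale// sqrtrM ?sqr_ge0// sqrtr_sqr ger0_norm.
move: Nk => _.
have [//|nS] := pselect (S (v + k)); exfalso.
(* If [v + k] is outside [S], then [sup A] is the time of exit, and it is not attained because [S]
   is relatively open. *)
pose A := [set t | 0 <= t <= 1 /\ S (v + t *: k)].
have A0 : A 0 by split; [rewrite lexx ler01|rewrite scale0r addr0].
have Aub : ubound A 1 by move=> t [/andP[]].
have supA : has_sup A by split; [exists 0|exists 1].
have s0 : 0 <= sup A by exact: (ub_le_sup supA.2).
have s1 : sup A <= 1 by apply: ge_sup => //; exists 0.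
have below t : 0 <= t -> t < sup A -> S (v + t *: k).
  move=> t0 /(sup_gt supA.1)[a [/andP[a0 a1] Sa] ta].
  have a0' : 0 < a by exact: le_lt_trans ta.
  have ta1 : 0 <= t / a <= 1 by rewrite divr_ge0//= ler_pdivrMr// mul1r ltW.
  have := relint_segment Sv Sa ta1.
  by rewrite [v + _ - v]addrAC subrr add0r scalerA divfK// gt_eqF.
have nSs : ~ S (v + sup A *: k).
  move=> Ss; have [d d0 Sd] := relint_open_line Ss Lk.
  have [s1'|s1'] := ltP (sup A) 1; last first.
    have e : sup A = 1 by apply/le_anti; rewrite s1.
    by apply: nS; move: Ss; rewrite e scale1r.
  pose t := Num.min (d / 2) (1 - sup A).
  have t0 : 0 < t by rewrite lt_min divr_gt0//= subr_gt0.
  have td : `|t| < d by rewrite gtr0_norm// gt_min; apply/orP; left; lra.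
  have ts : t <= 1 - sup A by rewrite ge_min lexx orbT.
  have : A (sup A + t).
    by split; [apply/andP; split; lra|rewrite scalerDl addrA; exact: Sd].
  by move=> /(ub_le_sup supA.2) /=; lra.
have s0' : 0 < sup A.
  by rewrite lt_neqAle s0 andbT; apply/negP => /eqP e; apply: nSs; rewrite -e scale0r addr0.
(* Points of [S] converging to the exit point, along which the barrier property forces [F] to
   infinity. *)
pose u i : E := v + (sup A * (1 - i.+1%:R^-1)) *: k.
have inv01 i : 0 < (i.+1%:R^-1 : R) <= 1.
  by rewrite invr_gt0 ltr0n /= invf_le1 ?ltr0n// ler1n.
have Su i : S (u i).
  have /andP[i0 i1] := inv01 i.
  by apply: below; [rewrite mulr_ge0// subr_ge0|rewrite gtr_pMr// gtrBl].
have cvg_u : u @ \oo --> v + sup A *: k.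
  apply: cvgD; first exact: cvg_cst.
  apply: cvgZ; last exact: cvg_cst.
  rewrite -[X in _ --> X]mulr1; apply: cvgM; first exact: cvg_cst.
  rewrite -[X in _ --> X]subr0; apply: cvgB; first exact: cvg_cst.
  exact: cvg_harmonic.
have clS : (closure C `\` S) (v + sup A *: k).
  split=> // B /cvg_u [i _ /(_ i (leqnn i)) Bi]; exists (u i); split=> //.
  exact: relint_sub.
have := mb_barrier barrierF Su cvg_u clS.
(* This threshold bounds [F] at every [u i], by [bregman_upper] and [t * r <= r < 1]. *)
move=> /cvgryPgt/(_ (F v + `|dotp (G v) k| + 1 / (2 * (1 - r)))) [i _ /(_ i (leqnn i)) /=].
apply/negP; rewrite -leNgt /u; set t := sup A * _.
have /andP[i0 i1] := inv01 i.
have t0 : 0 <= t by rewrite mulr_ge0// subr_ge0.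
have t1 : t <= 1 by rewrite mulr_ile1// ?subr_ge0// gerBl ltW.
have St : S (v + t *: k) by exact: Su.
have := bregman_upper Sv St; rewrite rE//.
have tr : t * r <= r by rewrite ler_piMl.
move=> /(_ (le_lt_trans tr r1)) H.
have H1 : (t * r) ^+ 2 / (2 * (1 - t * r)) <= 1 / (2 * (1 - r)).
  have p1 : 0 < 1 - r by lra.
  have p2 : 0 < 1 - t * r by lra.
  have tr0 : 0 <= t * r by rewrite mulr_ge0.
  apply: ler_pM.
  - exact: sqr_ge0.
  - by rewrite invr_ge0 mulr_ge0// ltW.
  - by rewrite exprn_ile1//; lra.
  - by rewrite lef_pV2 ?posrE ?mulr_gt0// ler_pM2l//; lra.
have H2 : dotp (G v) (t *: k) <= `|dotp (G v) k|.
  rewrite dotpZr; apply: le_trans (ler_norm _) _; rewrite normrM ger0_norm//.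
  by rewrite ler_piMl.
lra.
Qed.

(** The support function of the open Dikin ellipsoid centred at 0. Strictness lets [dikin] apply to
    every competitor, and the supremum form gives Cauchy-Schwarz from homogeneity of [N v] alone,
    without inverting or polarising it. *)
Definition local_dual_norm v f : R :=
  sup [set dotp f k | k in [set k | L k /\ N v k < 1]].

Lemma hessian0 v : S v -> N v 0 = 0.
Proof. by move=> Sv; have := hessian_scale 0 direction0 Sv; rewrite scale0r expr0n mul0r. Qed.

Section LocalDualNorm.
Variables (v f : E).
Hypothesis Sv : S v.
Local Notation q := (local_dual_norm v f).
Local Notation unit_ball := [set k | L k /\ N v k < 1].

Let has_sup_q : has_sup [set dotp f k | k in unit_ball].
Proof.
split; first by exists (dotp f 0), 0 => //; split; [exact: direction0|rewrite hessian0].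
have [M HM] := boundedC f; exists (M + M) => _ [k [Lk Nk] <-].
have Sk := dikin Sv Lk Nk.
have := HM _ (relint_sub Sk); have := HM _ (relint_sub Sv).
by rewrite dotpDr !ler_norml => /andP[? _] /andP[_ ?]; lra.
Qed.

Lemma local_dual_norm_ge0 : 0 <= q.
Proof.
apply: (ub_le_sup has_sup_q.2); exists 0; last by rewrite dotp0r.
by split; [exact: direction0|rewrite hessian0].
Qed.

Lemma local_dual_norm_ge k : L k -> N v k < 1 -> dotp f k <= q.
Proof. by move=> Lk Nk; apply: (ub_le_sup has_sup_q.2); exists k. Qed.

Lemma local_dual_norm_le b : (forall k, L k -> N v k < 1 -> dotp f k <= b) -> q <= b.
Proof. by move=> H; apply: ge_sup; [exact: has_sup_q.1|move=> _ [k [Lk Nk] <-]; exact: H]. Qed.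

Lemma dotp_le_local_norms k : L k -> dotp f k <= q * Num.sqrt (N v k).
Proof.
move=> Lk; have q0 := local_dual_norm_ge0.
set r := Num.sqrt _; have r0 : 0 <= r by exact: sqrtr_ge0.
apply/ler_addgt0Pr => e e0.
have q1 : 0 < q + 1 by rewrite ltr_wpDl.
(* [c > r] puts [c^-1 *: k] in the open ball even when [r = 0], and the excess costs
   [q * (c - r) <= e]. *)
pose c := r + e / (q + 1).
have c0 : 0 < c by rewrite ltr_wpDl// divr_gt0.
have Nc : N v (c^-1 *: k) < 1.
  rewrite hessian_scale// exprVn -(sqr_sqrtr (hessian_ge0 Lk Sv)) -/r.
  by rewrite ltr_pdivrMl ?exprn_gt0// mulr1 ltr_sqr ?nnegrE ?(ltW c0)// ltrDl divr_gt0.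
have := local_dual_norm_ge (directionZ c^-1 Lk) Nc.
rewrite dotpZr ler_pdivrMl// => /le_trans; apply.
have : e / (q + 1) * q <= e by rewrite mulrAC ler_pdivrMr// ler_pM2l// lerDl.
by rewrite /c; lra.
Qed.

Lemma norm_dotp_le_local_norms k : L k -> `|dotp f k| <= q * Num.sqrt (N v k).
Proof.
move=> Lk; rewrite ler_norml dotp_le_local_norms// andbT lerNl -dotpNr.
have LNk : L (- k) by rewrite -scaleN1r; exact: directionZ.
apply: le_trans (dotp_le_local_norms LNk) _.
by rewrite -scaleN1r hessian_scale// sqrrN expr1n mul1r.
Qed.

End LocalDualNorm.


(** * The Legendre-Fenchel dual and its first two derivatives *)

Definition dual_pair h v := S v /\ forall k, L k -> dotp h k = dotp (G v) k.

Lemma dual_pair_grad v : S v -> dual_pair (G v) v.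
Proof. by []. Qed.

(** An arbitrary [h] need not lie in [L], whereas gradients do, so the two are compared as
    functionals on [L]; there [h] is represented by a vector of [L], and the gradient is onto. *)
Lemma ex_dual_pair h : exists v, dual_pair h v.
Proof.
have [|g Lg gP] := @subspace_representation _ _ _ L (dotp h) direction_subspace.
  by move=> a u v _ _; rewrite dotpDr dotpZr.
have [_ _ /(_ _ Lg)[v Sv vE]] := mb_grad_bij barrierF.
by exists v; split=> // k Lk; rewrite vE; exact: gP.
Qed.

(** The tangent inequality at [v] makes [v] a maximiser in the definition of the dual. *)
Lemma fdual_ub h v : dual_pair h v ->
  ubound [set dotp h w - F w | w in S] (dotp h v - F v).
Proof.
move=> [Sv hv] _ [w Sw <-]; have := grad_le Sv Sw.
by rewrite -hv ?dotpBr; [lra|exact: relint_direction].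
Qed.

Lemma fdualE h v : dual_pair h v -> fdual C F h = dotp h v - F v.
Proof.
move=> hv; apply/le_anti/andP; split.
  by apply: ge_sup; [exists (dotp h v - F v), v => //; exact: hv.1|exact: fdual_ub].
apply: ub_le_sup; first by exists (dotp h v - F v); exact: fdual_ub.
by exists v => //; exact: hv.1.
Qed.

Lemma fdual_ge h v : S v -> dotp h v - F v <= fdual C F h.
Proof.
move=> Sv; have [w hw] := ex_dual_pair h.
by rewrite (fdualE hw); apply: (fdual_ub hw); exists v.
Qed.

Section DualPerturbation.
Variables (h f v : E).
Hypothesis hv : dual_pair h v.
Local Notation q := (local_dual_norm v f).

(** On [L] the gradients at [w] and [v] differ by [s *: f]. With [r] the local length of [w - v],
    the bounds are the gradient gap, Cauchy-Schwarz and the lower bound on the Bregman divergence of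
    [w] from [v]. *)
Lemma dual_pair_perturbation s w : dual_pair (h + s *: f) w ->
  exists r, [/\ 0 <= r, r ^+ 2 / (1 + r) <= s * dotp f (w - v),
    s * dotp f (w - v) <= `|s| * q * r &
    r ^+ 2 / (2 * (1 + r)) <= F w - F v - dotp h (w - v)].
Proof.
move=> [Sw hw]; have [Sv hvk] := hv; have Lk := relint_direction Sv Sw.
exists (Num.sqrt (N v (w - v))); split; first exact: sqrtr_ge0.
- have := @grad_gap_ge v (w - v) Sv; rewrite [v + _]addrC subrK => /(_ Sw).
  by rewrite -hw// -hvk// dotpDl dotpZl [dotp h _ + _]addrC addrK.
- apply: le_trans (ler_norm _) _; rewrite normrM -mulrA ler_wpM2l//.
  exact: norm_dotp_le_local_norms.
- have := @bregman_lower v (w - v) Sv; rewrite [v + _]addrC subrK => /(_ Sw).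
  by rewrite -hvk.
Qed.

Let remainder s := fdual C F (h + s *: f) - fdual C F h - s * dotp f v.

(** The duals at [h + s *: f] and [h] are attained at [w] and [v]; the subtracted term is the
    Bregman divergence of [w] from [v]. *)
Let remainderE s w : dual_pair (h + s *: f) w ->
  remainder s = s * dotp f (w - v) - (F w - F v - dotp h (w - v)).
Proof.
by move=> hw; rewrite /remainder (fdualE hw) (fdualE hv) dotpDl dotpZl !dotpBr; lra.
Qed.

Let remainder_ge0 s : 0 <= remainder s.
Proof.
have := fdual_ge (h + s *: f) hv.1.
by rewrite /remainder (fdualE hv) dotpDl dotpZl; lra.
Qed.

Let q0 : 0 <= q. Proof. exact: local_dual_norm_ge0 hv.1. Qed.

(** The dual at [h + s *: f] is tested at [v + (s * q) *: k], with [k] in the unit ball. The linear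
    gain is [s ^+ 2 * q * dotp f k], the loss is at most that of [bregman_upper], and the supremum
    over [k] replaces [dotp f k] by [q]. *)
Let remainder_ge s : `|s| * q <= 1 / 2 ->
  (`|s| * q) ^+ 2 - (`|s| * q) ^+ 2 / (2 * (1 - `|s| * q)) <= remainder s.
Proof.
set sg := `|s| * q => sg_le; have sg0 : 0 <= sg by rewrite mulr_ge0.
have [Sv hvk] := hv.
have main k : L k -> N v k < 1 ->
    s ^+ 2 * q * dotp f k <= remainder s + sg ^+ 2 / (2 * (1 - sg)).
  move=> Lk Nk; have Lk1 := directionZ (s * q) Lk.
  have [r [r0 r1 rE]] : exists r : R, [/\ 0 <= r, r <= 1 &
      Num.sqrt (N v ((s * q) *: k)) = sg * r].
    exists (Num.sqrt (N v k)); split; first exact: sqrtr_ge0.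
      by rewrite -[X in _ <= X]sqrtr1; apply: ler_wsqrtr; exact: ltW.
    by rewrite hessian_scale// sqrtrM ?sqr_ge0// sqrtr_sqr normrM (ger0_norm q0).
  have Sk1 : S (v + (s * q) *: k).
    have sq1 : (s * q) ^+ 2 <= 1.
      rewrite -real_normK ?num_real// normrM (ger0_norm q0) -/sg exprn_ile1//.
      by lra.
    apply: (dikin Sv Lk1); rewrite (hessian_scale _ Lk Sv).
    exact: le_lt_trans (ler_piMl (hessian_ge0 Lk Sv) sq1) Nk.
  move: Nk => _.
  have sgr : sg * r <= sg by rewrite ler_piMr.
  have sgr0 : 0 <= sg * r by rewrite mulr_ge0.
  have := bregman_upper Sv Sk1; rewrite rE => /(_ ltac:(lra)).
  have e1 : (sg * r) ^+ 2 / (2 * (1 - sg * r)) <= sg ^+ 2 / (2 * (1 - sg)).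
    apply: ler_pM.
    - exact: sqr_ge0.
    - by rewrite invr_ge0 mulr_ge0//; lra.
    - by rewrite ler_sqr.
    - rewrite lef_pV2 ?posrE ?mulr_gt0//; [|lra|lra].
      by rewrite ler_pM2l//; lra.
  move=> /le_trans/(_ e1) e2; have := fdual_ge (h + s *: f) Sk1.
  move: e2; rewrite -hvk// /remainder (fdualE hv) dotpDl dotpZl !dotpDr !dotpZr.
  lra.
rewrite -/sg lerBlDr.
have sgE : sg ^+ 2 = s ^+ 2 * q * q by rewrite /sg exprMn real_normK ?num_real//; ring.
rewrite [X in X <= _]sgE.
have rem0 : 0 <= remainder s + sg ^+ 2 / (2 * (1 - sg)).
  by rewrite addr_ge0 ?remainder_ge0// divr_ge0 ?sqr_ge0// mulr_ge0//; lra.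
have : 0 <= s ^+ 2 * q by rewrite mulr_ge0// sqr_ge0.
(* The supremum over [k] is taken after division by [s ^+ 2 * q], so the zero case is separate. *)
rewrite le_eqVlt => /predU1P[<-|sq0]; first by rewrite mul0r; exact: rem0.
rewrite mulrC -ler_pdivlMr//; apply: (local_dual_norm_le Sv) => k Lk Nk.
rewrite ler_pdivlMr// mulrC; exact: main.
Qed.

Let small e : 0 < e -> exists2 d, 0 < d &
  forall s, `|s| < d -> `|s| * q <= 1 / 2 /\ `|s| * (q + 1) ^+ 5 <= e.
Proof.
move=> e0; have q1 : 0 < q + 1 by rewrite ltr_wpDl.
exists (Num.min ((1 / 2) / (q + 1)) (e / (q + 1) ^+ 5)).
  by rewrite lt_min !divr_gt0// exprn_gt0.
move=> s; rewrite lt_min => /andP[s1 s2]; split.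
  apply: le_trans (_ : `|s| * (q + 1) <= _); first by rewrite ler_wpM2l// lerDl.
  by rewrite -ler_pdivlMr// ltW.
by rewrite -ler_pdivlMr ?exprn_gt0// ltW.
Qed.

(** The remainder lies between 0 and [2 * (s * q)^2], the upper bound coming from the step estimate
    [r <= 2 * (|s| * q)]. *)
Lemma is_derive_fdual : is_derive h f (fdual C F) (dotp v f).
Proof.
apply: (iffRL (is_deriveP (fdual C F) h f (dotp v f))) => e e0.
have [d d0 sd] := small (divr_gt0 e0 (ltr0Sn R 1)).
exists d => // s /sd[s1 s2].
rewrite dotpC -/(remainder s) ger0_norm//.
have [w hw] := ex_dual_pair (h + s *: f).
have [r [r0 r1 r2 r3]] := dual_pair_perturbation hw.
have sg0 : 0 <= `|s| * q by rewrite mulr_ge0.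
have rs := local_step_le r0 r1 r2 (ltac:(by rewrite sg0) : 0 <= `|s| * q <= 1 / 2).
have r30 : 0 <= r ^+ 2 / (2 * (1 + r)) by rewrite divr_ge0 ?sqr_ge0// mulr_ge0//; lra.
have : remainder s <= `|s| * (2 * (`|s| * q ^+ 2)).
  rewrite (remainderE hw).
  have : `|s| * q * r <= `|s| * q * (2 * (`|s| * q)) by rewrite ler_wpM2l.
  have -> : `|s| * (2 * (`|s| * q ^+ 2)) = `|s| * q * (2 * (`|s| * q)) by ring.
  lra.
move=> /le_trans; apply; rewrite mulrC ler_wpM2r//.
suff : `|s| * q ^+ 2 <= `|s| * (q + 1) ^+ 5 by lra.
rewrite ler_wpM2l//; apply: le_trans (_ : (q + 1) ^+ 2 <= _).
  by rewrite ler_sqr ?nnegrE ?addr_ge0// lerDl.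
by rewrite ler_weXn2l// lerDr.
Qed.

(** [remainder_ge] and the lower bound on the divergence of [w] from [v] supply the last hypothesis
    of [second_order_gap]. *)
Lemma dual_gap_second_order s w : dual_pair (h + s *: f) w -> `|s| * q <= 1 / 2 ->
  (s * dotp f (w - v) - (`|s| * q) ^+ 2) ^+ 2 <= 10 * (`|s| * q) ^+ 5.
Proof.
move=> hw s1; have [r [r0 r1 r2 r3]] := dual_pair_perturbation hw.
have sg0 : 0 <= `|s| * q by rewrite mulr_ge0.
have sg01 : 0 <= `|s| * q <= 1 / 2 by rewrite sg0.
have rs := local_step_le r0 r1 r2 sg01.
apply: (second_order_gap r0) => //.
  by apply: le_trans r1; rewrite divr_ge0 ?sqr_ge0//; lra.
by have := remainder_ge s1; rewrite (remainderE hw); lra.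
Qed.

End DualPerturbation.

Lemma grad_fdual h v : dual_pair h v -> grad setT (fdual C F) h = v.
Proof.
move=> hv; have [|_ H] := @getPex _ [set g | [set: E] g /\ forall k, [set: E] k ->
    is_derive h k (fdual C F) (dotp g k)].
  by exists v; split=> // k _; exact: is_derive_fdual.
apply: dotp_inj => k.
by have [_ <-] := H k I; have [_ ->] := is_derive_fdual k hv.
Qed.

Lemma dual_pair_grad_fdual h : dual_pair h (grad setT (fdual C F) h).
Proof. by have [v hv] := ex_dual_pair h; rewrite (grad_fdual hv). Qed.

(** Dividing the second-order gap by [s ^+ 2] bounds the squared error of the difference quotient by
    [10 * q^5 * |s|]. *)
Lemma is_derive_grad_fdual h v f : dual_pair h v ->
  is_derive h f (fun g => dotp (grad setT (fdual C F) g) f) (local_dual_norm v f ^+ 2).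
Proof.
move=> hv; set q := local_dual_norm v f.
have q0 : 0 <= q by exact: local_dual_norm_ge0 hv.1.
have q1 : 0 < q + 1 by rewrite ltr_wpDl.
apply: (iffRL (is_deriveP _ _ _ _)) => e e0.
(* The first radius allows the gap estimate, the second makes the squared error at most [e ^+ 2];
   [q + 1] keeps both positive denominators when [q = 0]. *)
pose d := Num.min (1 / 2 / (q + 1)) (e ^+ 2 / (10 * (q + 1) ^+ 5)).
have d0 : 0 < d by rewrite lt_min !divr_gt0 ?mulr_gt0 ?exprn_gt0.
exists d => // s; rewrite lt_min => /andP[s1 s2].
have [->|sN0] := eqVneq s 0.
  by rewrite scale0r addr0 mul0r subr0 subrr normr0 mulr0.
have sp : 0 < `|s| by rewrite normr_gt0.
have [w hw] := ex_dual_pair (h + s *: f).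
rewrite (grad_fdual hw) (grad_fdual hv) -dotpBl dotpC.
have sq : `|s| * q <= 1 / 2.
  apply: le_trans (_ : `|s| * (q + 1) <= _); first by rewrite ler_wpM2l// lerDl.
  by rewrite -ler_pdivlMr// ltW.
have := dual_gap_second_order hv hw sq; rewrite -/q => H.
rewrite -(ler_pM2r sp) -normrM.
have se : `|s| * (10 * q ^+ 5) <= e ^+ 2.
  apply: le_trans (_ : `|s| * (10 * (q + 1) ^+ 5) <= _).
    by rewrite ler_wpM2l// ler_wpM2l// lerXn2r ?nnegrE ?(ltW q1)// lerDl.
  by rewrite -ler_pdivlMr ?mulr_gt0 ?exprn_gt0// ltW.
have -> : (dotp f (w - v) - s * q ^+ 2) * s = s * dotp f (w - v) - (`|s| * q) ^+ 2.
  by rewrite exprMn real_normK ?num_real//; ring.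
have es0 : 0 <= e * `|s| * `|s| by rewrite !mulr_ge0// ltW.
rewrite -(ger0_norm es0) -ler_sqr ?nnegrE ?normr_ge0// !real_normK ?num_real//.
apply: le_trans H _.
have -> : 10 * (`|s| * q) ^+ 5 = `|s| * (10 * q ^+ 5) * `|s| ^+ 4 by ring.
have -> : (e * `|s| * `|s|) ^+ 2 = e ^+ 2 * `|s| ^+ 4 by ring.
by rewrite ler_wpM2r// exprn_ge0.
Qed.

(** Translates the hypotheses on [dual_norm] into bounds on the support function used by the step
    estimates. *)
Lemma dual_normE v f : S v -> dual_norm C F (G v) f = local_dual_norm v f.
Proof.
move=> Sv; rewrite /dual_norm.
have -> : 'D_f (fdual C F) = fun h => dotp (grad setT (fdual C F) h) f.
  by apply/funext => h; apply: derive_val; apply: is_derive_fdual; exact: dual_pair_grad_fdual.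
have [_ ->] := is_derive_grad_fdual f (dual_pair_grad Sv).
by rewrite sqrtr_sqr ger0_norm// local_dual_norm_ge0.
Qed.

(** * Regret of mirror descent *)

Lemma mirror_step v f rho : S v -> 0 < rho ->
  rho * dual_norm C F (G v) f <= 1 / 2 -> dual_norm C F (G v) f <= 1 ->
  let w := grad setT (fdual C F) (G v - rho *: f) in
  forall mu, S mu -> dotp v f - dotp mu f
    <= rho^-1 * bregman C F mu v - rho^-1 * bregman C F mu w + 2 * rho.
Proof.
move=> Sv rho0; rewrite dual_normE// => q1 q2 w mu Smu.
set q := local_dual_norm v f in q1 q2.
have q0 : 0 <= q by exact: local_dual_norm_ge0.
have hv := dual_pair_grad Sv.
have hw : dual_pair (G v + (- rho) *: f) w by rewrite scaleNr; exact: dual_pair_grad_fdual.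
have [r [r0 r1 r2 r3]] := dual_pair_perturbation hv hw.
move: r2; rewrite normrN (gtr0_norm rho0) -/q => r2.
have rq0 : 0 <= rho * q by rewrite mulr_ge0// ltW.
have rs := local_step_le r0 r1 r2 (ltac:(by rewrite rq0) : 0 <= rho * q <= 1 / 2).
have A : - rho * dotp f (w - v) <= rho * (2 * rho).
  apply: le_trans r2 _; apply: le_trans (ler_wpM2l rq0 rs) _.
  have -> : rho * q * (2 * (rho * q)) = rho * (2 * rho) * q ^+ 2 by ring.
  by rewrite ler_piMr// ?exprn_ile1// !mulr_ge0// ltW.
have r30 : 0 <= r ^+ 2 / (2 * (1 + r)) by rewrite divr_ge0 ?sqr_ge0// mulr_ge0//; lra.
(* [G w] agrees with [G v - rho *: f] only as a functional on [L], which contains [mu - w]. *)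
have Gw := hw.2 _ (relint_direction hw.1 Smu).
rewrite -(ler_pM2l rho0).
have -> b b' : rho * (rho^-1 * b - rho^-1 * b' + 2 * rho) = b - b' + rho * (2 * rho).
  by field; rewrite gt_eqF.
(* Three-point identity: the divergence of [w] from [v], nonnegative by [r3], is dropped, and [A]
   bounds the remaining term. *)
rewrite /bregman -Gw; move: A r3; rewrite !dotpDl !dotpZl !dotpBr (dotpC v) (dotpC mu).
lra.
Qed.

Lemma md_initP : S (md_init C F).
Proof.
have [[v Sv Fv] F0] := mb_min barrierF.
have [|//] := @getPex _ [set v | S v /\ forall w, S w -> F v <= F w].
by exists v; split=> // w Sw; rewrite Fv; exact: F0.
Qed.

Lemma md_relint rho fs : S (md C F rho fs).
Proof.
elim/last_ind: fs => [|fs g _]; first exact: md_initP.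
by rewrite /md -cats1 foldl_cat /=; case: (dual_pair_grad_fdual (G (md C F rho fs) - rho *: g)).
Qed.

Lemma mirror_descent_regret (rho : R) (fs : seq E) : 0 < rho ->
  (forall t : nat, (t < size fs)%N ->
    rho * dual_norm C F (G (md C F rho (take t fs))) fs`_t <= 1 / 2 /\
    dual_norm C F (G (md C F rho (take t fs))) fs`_t <= 1) ->
  forall mu, S mu ->
    \sum_(t < size fs) (dotp (md C F rho (take t fs)) fs`_t - dotp mu fs`_t)
    <= rho^-1 * bregman C F mu (md_init C F) - rho^-1 * bregman C F mu (md C F rho fs)
       + 2 * rho * (size fs)%:R.
Proof.
(* Induction from the right, since [md] is a left fold; the divergence from the last iterate is kept
   so that the sum telescopes. *)
move=> rho0 + mu Smu; elim/last_ind: fs => [_|fs g IH H].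
  by rewrite big_ord0 /= mulr0 addr0 subrr.
rewrite size_rcons big_ord_recr /=.
have tk (t : nat) : (t <= size fs)%N -> take t (rcons fs g) = take t fs.
  by move=> tf; rewrite -cats1 takel_cat.
have nt (t : nat) : (t < size fs)%N -> (rcons fs g)`_t = fs`_t by move=> tf; rewrite nth_rcons tf.
have {IH} IH := IH (fun (t : nat) tf => ltac:(
  by have := H t; rewrite size_rcons (tk _ (ltnW tf)) (nt _ tf) => /(_ (ltnW tf)))).
have [] := H (size fs); first by rewrite size_rcons.
rewrite tk// take_size nth_rcons ltnn eqxx => h1 h2.
have st := mirror_step (md_relint rho fs) rho0 h1 h2 Smu.
have -> : md C F rho (rcons fs g) =
    grad setT (fdual C F) (G (md C F rho fs) - rho *: g).
  by rewrite /md -cats1 foldl_cat.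
rewrite (eq_bigr (fun t : 'I_(size fs) =>
    dotp (md C F rho (take t fs)) fs`_t - dotp mu fs`_t)); last first.
  by move=> t _; rewrite tk ?nt// ltnW.
rewrite -(natr1 (size fs)).
by move: IH st; lra.
Qed.

End MirrorBarrier.

(** * Controlled Markov chains *)

Section MarkovChains.
Context {R : realType} {X U : finType}.
Local Notation E := 'M[R]_(#|X|, #|U|).
Variable K : X -> U -> X -> R.
Hypothesis hK : forall x u, is_dist (K x u).
Implicit Types (P : X -> U -> R) (mu pi : X -> R) (Q : nat -> X -> U -> R)
  (g nu : E).

Lemma push_dist P mu : markov_matrix P -> is_dist mu -> is_dist (push K P mu).
Proof.
move=> hP [mu0 mu1]; split=> [y|].
  apply: sumr_ge0 => x _; apply: mulr_ge0 => //; apply: sumr_ge0 => u _.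
  by apply: mulr_ge0; [exact: (hK x u).1|exact: (hP x).1].
rewrite /push exchange_big -[RHS]mu1; apply: eq_bigr => x _.
rewrite -mulr_sumr exchange_big (eq_bigr (P x)) ?(hP x).2 ?mulr1// => u _.
by rewrite -mulr_suml (hK x u).2 mul1r.
Qed.

Lemma l1dist_triangle (A : finType) (p q r : A -> R) :
  l1dist p r <= l1dist p q + l1dist q r.
Proof. by rewrite -big_split; apply: ler_sum => a _; exact: ler_distD. Qed.

Lemma l1dist_le2 (A : finType) (p q : A -> R) : is_dist p -> is_dist q -> l1dist p q <= 2.
Proof.
move=> [p0 p1] [q0 q1]; have -> : 2 = \sum_a (p a + q a) by rewrite big_split /= p1 q1.
by apply: ler_sum => a _; apply: le_trans (ler_normB _ _) _; rewrite !ger0_norm.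
Qed.

(** Averaging over [mu] and moving through [K] do not increase the l1 distance. *)
Lemma l1dist_push_policies P P' mu (d : R) : is_dist mu ->
  (forall x, l1dist (P x) (P' x) <= d) -> l1dist (push K P mu) (push K P' mu) <= d.
Proof.
move=> [mu0 mu1] Pd.
apply: le_trans (_ : \sum_y \sum_x mu x * \sum_u K x u y * `|P x u - P' x u| <= _).
  apply: ler_sum => y _; rewrite -sumrB; apply: le_trans (ler_norm_sum _ _ _) _.
  apply: ler_sum => x _; rewrite -mulrBr -sumrB normrM ger0_norm// ler_wpM2l//.
  apply: le_trans (ler_norm_sum _ _ _) _; apply: ler_sum => u _.
  by rewrite -mulrBr normrM ger0_norm// (hK x u).1.
rewrite exchange_big /= -[leRHS]mul1r -mu1 mulr_suml; apply: ler_sum => x _.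
rewrite -mulr_sumr ler_wpM2l// exchange_big /=; apply: le_trans (Pd x).
by apply: ler_sum => u _; rewrite -mulr_suml (hK x u).2 mul1r.
Qed.

Lemma dotp_ent g nu : dotp nu g = \sum_x \sum_u ent nu x u * ent g x u.
Proof.
rewrite /dotp (reindex (@enum_rank X)) /=; last exact: onW_bij (@enum_rank_bij X).
by apply: eq_bigr => x _; rewrite (reindex (@enum_rank U)) //=; exact: onW_bij (@enum_rank_bij U).
Qed.

Lemma ent_otimes pi P x u : ent (otimes pi P) x u = pi x * P x u.
Proof. by rewrite /ent mxE !enum_rankK. Qed.

Lemma normr_ent_le g x u : `|ent g x u| <= `|g|.
Proof.
rewrite /ent {2}/Num.norm/= mx_normrE.
exact: (le_bigmax _ (fun ij : 'I_#|X| * 'I_#|U| => `|g ij.1 ij.2|) (enum_rank x, enum_rank u)).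
Qed.

Lemma cost_gap_le P mu pi g : markov_matrix P ->
  dotp (otimes mu P) g - dotp (otimes pi P) g <= `|g| * l1dist mu pi.
Proof.
move=> hP; rewrite !dotp_ent -sumrB mulr_sumr; apply: ler_sum => x _.
rewrite -sumrB; apply: le_trans (_ : \sum_u (`|mu x - pi x| * `|g|) * P x u <= _).
  apply: ler_sum => u _; rewrite !ent_otimes -mulrBl -mulrBl.
  apply: le_trans (ler_norm _) _; rewrite !normrM (ger0_norm ((hP x).1 u)).
  by rewrite mulrAC ler_wpM2r ?(hP x).1// ler_wpM2l// normr_ent_le.
by rewrite -mulr_sumr (hP x).2 mulr1 mulrC.
Qed.

Definition marginal nu : X -> R := fun x => \sum_u ent nu x u.

Lemma marginal_dist nu : polytope K nu -> is_dist (marginal nu).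
Proof. by move=> [nu0 nu1 _]; split=> // x; apply: sumr_ge0 => u _. Qed.

(** At a state of zero mass all entries are zero by nonnegativity, so the factorisation holds for
    any choice of [P] there. *)
Lemma ent_induced nu P x u : polytope K nu -> induced_policy nu P ->
  ent nu x u = marginal nu x * P x u.
Proof.
move=> [nu0 _ _] [_ hP]; have [z|nz] := eqVneq (marginal nu x) 0.
  move: (z) => /eqP; rewrite psumr_eq0// => /allP /(_ u).
  rewrite mem_index_enum => /(_ isT) /eqP ->.
  by rewrite z mul0r.
by rewrite hP// mulrC divfK.
Qed.

Lemma otimes_marginal nu P : polytope K nu -> induced_policy nu P ->
  otimes (marginal nu) P = nu.
Proof.
move=> Cnu hP; apply/matrixP => i j.
have := ent_otimes (marginal nu) P (enum_val i) (enum_val j).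
by rewrite -(ent_induced _ _ Cnu hP) /ent !enum_valK.
Qed.

(** The balance equations of the polytope, read through the factorisation of [nu]. *)
Lemma push_marginal nu P : polytope K nu -> induced_policy nu P ->
  push K P (marginal nu) = marginal nu.
Proof.
move=> Cnu hP; apply/funext => y; have [_ _ /(_ y) inv] := Cnu.
rewrite [RHS]/marginal -inv; apply: eq_bigr => x _; rewrite mulr_sumr; apply: eq_bigr => u _.
by rewrite (ent_induced _ _ Cnu hP) mulrCA.
Qed.

(** * Contraction and drift of invariant distributions *)

Section Mixing.
Variable tau : R.
Hypothesis hmix : uniform_mixing K tau.
Local Notation a := (expR (- tau^-1)).

Let tau_gt0 : 0 < tau. Proof. exact: lt_le_trans (hmix.1). Qed.

(** From [expR tau^-1 >= 1 + tau^-1] one gets [a <= tau / (tau + 1)]. *)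
Lemma mixing_gap : 1 <= (tau + 1) * (1 - a).
Proof.
have : 1 + tau^-1 <= expR tau^-1 by exact: expR_ge1Dx.
have e0 : 0 < expR tau^-1 by exact: expR_gt0.
have ti0 : 0 < tau^-1 by rewrite invr_gt0.
rewrite expRN; set e := expR _ in e0 *; set i := tau^-1 in ti0 *.
have ti : tau * i = 1 by rewrite divff// gt_eqF.
have ei : e * e^-1 = 1 by rewrite divff// gt_eqF.
have ei0 : 0 < e^-1 by rewrite invr_gt0.
move=> h; have : (tau + 1) * e^-1 <= tau.
  rewrite ler_pdivrMr//; have := ler_wpM2l (ltW tau_gt0) h; lra.
lra.
Qed.

Lemma mixing_lt1 : a < 1.
Proof. by rewrite -expR0 ltr_expR oppr_lt0 invr_gt0. Qed.

(** The marginal is invariant, and a strict contraction has at most one invariant distribution. *)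
Lemma inv_distE nu P : polytope K nu -> induced_policy nu P ->
  inv_dist K P = marginal nu.
Proof.
move=> Cnu hP; have mP := marginal_dist Cnu.
have [|piD piE] := @getPex _ [set pi : X -> R | is_dist pi /\ push K P pi = pi].
  by exists (marginal nu); split=> //; exact: push_marginal.
rewrite -/(inv_dist K P) in piD piE.
have := hmix.2 P _ _ hP.1 piD mP; rewrite piE (push_marginal Cnu hP).
set d := l1dist _ _ => h.
have d0 : 0 <= d by apply: sumr_ge0.
have /eqP : d = 0 by apply/le_anti; rewrite d0 andbT; have := mixing_lt1; nra.
rewrite psumr_eq0// => /allP H; apply/funext => x.
by have := H x; rewrite mem_index_enum normr_eq0 subr_eq0 => /(_ isT) /eqP.
Qed.

(** Comparing both marginals with the push of [marginal nu] by [P'] gives [D <= d + a * D], and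
    [mixing_gap] bounds [1 / (1 - a)]. *)
Lemma invariant_drift nu nu' P P' (d : R) : polytope K nu -> polytope K nu' ->
  induced_policy nu P -> induced_policy nu' P' ->
  (forall x, l1dist (P x) (P' x) <= d) ->
  l1dist (marginal nu) (marginal nu') <= (tau + 1) * d.
Proof.
move=> Cnu Cnu' hP hP' Pd.
have m := marginal_dist Cnu; have m' := marginal_dist Cnu'.
have h1 := l1dist_push_policies m Pd.
have h2 := hmix.2 P' _ _ hP'.1 m m'.
have h3 := l1dist_triangle (push K P (marginal nu)) (push K P' (marginal nu))
  (push K P' (marginal nu')).
move: h1 h2 h3; rewrite (push_marginal Cnu hP) (push_marginal Cnu' hP').
set D := l1dist (marginal nu) (marginal nu') => h1 h2 h3.
have D0 : 0 <= D by apply: sumr_ge0.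
have h4 : (1 - a) * D <= d by lra.
have t0 : 0 <= tau + 1 by rewrite addr_ge0// ltW.
have := ler_wpM2l t0 h4; have := ler_wpM2r D0 mixing_gap; lra.
Qed.

End Mixing.

(** The extra [a * D T] on the left is what the next step of the recursion consumes. *)
Lemma contraction_sum (D : nat -> R) (a c : R) (T : nat) :
  D 0%N <= 2 -> (forall t, (t.+1 < T.+1)%N -> D t.+1 <= a * D t + c) ->
  (1 - a) * (\sum_(t < T.+1) D t) + a * D T <= 2 + T%:R * c.
Proof.
move=> D0; elim: T => [_|T IH H]; first by rewrite big_ord1 mul0r; lra.
have {}IH := IH (fun t tT => H t (ltnW tT)).
have := H T (ltnSn _); rewrite big_ord_recr /= -(natr1 T); lra.
Qed.

Fixpoint state_law Q mu (t : nat) : X -> R :=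
  if t is t'.+1 then push K (Q t') (state_law Q mu t') else mu.

Lemma state_law_shift Q mu t :
  state_law (Q \o S) (push K (Q 0%N) mu) t = state_law Q mu t.+1.
Proof. by elim: t => //= t ->. Qed.

(** The cost in round [t] exceeds its stationary value by at most [c] times the distance from the
    state law to the marginal of [nus t]; these distances satisfy a contracting recursion started at
    2 or less. *)
Lemma tracking_cost (tau d c : R) (T : nat) Q (nus : nat -> E) mu (g : nat -> E) :
  uniform_mixing K tau -> 0 <= d -> 0 <= c -> is_dist mu ->
  (forall t, (t < T)%N -> polytope K (nus t)) ->
  (forall t, (t < T)%N -> induced_policy (nus t) (Q t)) ->
  (forall t x, (t.+1 < T)%N -> l1dist (Q t x) (Q t.+1 x) <= d) ->
  (forall t, (t < T)%N -> `|g t| <= c) ->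
  \sum_(t < T) dotp (otimes (state_law Q mu t) (Q t)) (g t)
  <= \sum_(t < T) dotp (nus t) (g t)
     + c * ((tau + 1) ^+ 2 * T%:R * d) + (2 * tau + 2) * c.
Proof.
move=> hmix d0 c0 hmu Cnu hQ Qd gc.
have tau0 : 0 < tau by apply: lt_le_trans hmix.1.
case: T => [|T] in Cnu hQ Qd gc *.
  rewrite !big_ord0 add0r mulr0 mul0r mulr0 add0r mulr_ge0//.
  by rewrite addr_ge0// mulr_ge0// ltW.
pose D t := l1dist (state_law Q mu t) (marginal (nus t)).
have muD t : (t <= T)%N -> is_dist (state_law Q mu t).
  elim: t => //= t IH tT; apply: push_dist; last exact: IH (ltnW tT).
  exact: (hQ t (ltnW tT)).1.
have D_ge0 t : 0 <= D t by apply: sumr_ge0.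
have D0 : D 0%N <= 2 by apply: l1dist_le2 => //; apply: marginal_dist; exact: Cnu.
have DS t : (t.+1 < T.+1)%N -> D t.+1 <= expR (- tau^-1) * D t + (tau + 1) * d.
  move=> tT; have tT' := ltnW tT; rewrite ltnS in tT'.
  have Ct := Cnu t tT'; have Ct1 := Cnu _ tT.
  apply: le_trans (l1dist_triangle _ (marginal (nus t)) _) _; apply: lerD.
    (* Invariance writes the marginal as a push by the same policy, so mixing applies. *)
    rewrite /= -{1}(push_marginal Ct (hQ t tT')); apply: hmix.2.
    - exact: (hQ t tT').1.
    - exact: muD.
    - exact: marginal_dist.
  exact: (invariant_drift hmix Ct Ct1 (hQ t tT') (hQ _ tT) (fun x => Qd t x tT)).
have S0 : 0 <= \sum_(t < T.+1) D t by apply: sumr_ge0.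
have sumD : \sum_(t < T.+1) D t <= (tau + 1) * (2 + T%:R * ((tau + 1) * d)).
  have h1 := contraction_sum D0 DS.
  have h2 : 0 <= expR (- tau^-1) * D T by rewrite mulr_ge0// expR_ge0.
  have h3 : (1 - expR (- tau^-1)) * (\sum_(t < T.+1) D t) <= 2 + T%:R * ((tau + 1) * d).
    by lra.
  have t1 : 0 <= tau + 1 by rewrite addr_ge0// ltW.
  have := ler_wpM2l t1 h3; have := ler_wpM2r S0 (mixing_gap hmix); lra.
have gap : \sum_(t < T.+1) dotp (otimes (state_law Q mu t) (Q t)) (g t)
    - \sum_(t < T.+1) dotp (nus t) (g t) <= c * \sum_(t < T.+1) D t.
  rewrite -sumrB mulr_sumr; apply: ler_sum => t _.
  rewrite -{1}(otimes_marginal (Cnu t (ltn_ord t)) (hQ t (ltn_ord t))).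
  apply: le_trans (cost_gap_le _ _ _ (hQ t (ltn_ord t)).1) _.
  by apply: (ler_wpM2r (D_ge0 t)); exact: gc.
have h1 := ler_wpM2l c0 sumD.
(* There are [T.+1] rounds but only [T] policy changes. *)
have h2 : c * ((tau + 1) ^+ 2 * T%:R * d) <= c * ((tau + 1) ^+ 2 * T.+1%:R * d).
  by rewrite ler_wpM2l// ler_wpM2r// ler_wpM2l ?sqr_ge0// ler_nat.
lra.
Qed.

(** * Laws of trajectories and expected costs *)

Section Trajectories.

(** Against an oblivious environment the policies depend on the round alone, so deleting the first
    round amounts to replacing [Q] by [Q \o S]. *)
Definition law Q (x : X) T (w : @trajectory X U T) : R :=
  (w.1 ord0 == x)%:R *
  \prod_(t < T) (Q t (state_at w t) (action_at w t)
                 * K (state_at w t) (action_at w t) (next_state w t)).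

Definition fcons (A : Type) (n : nat) (a : A) (s : {ffun 'I_n -> A}) : {ffun 'I_n.+1 -> A} :=
  [ffun i => if unlift ord0 i is Some j then s j else a].

Lemma fcons0 A n a (s : {ffun 'I_n -> A}) : fcons a s ord0 = a.
Proof. by rewrite ffunE unlift_none. Qed.

Lemma fconsS A n a (s : {ffun 'I_n -> A}) i : fcons a s (lift ord0 i) = s i.
Proof. by rewrite ffunE liftK. Qed.

Definition tcons T (x : X) (u : U) (w : @trajectory X U T) : @trajectory X U T.+1 :=
  (fcons x w.1, fcons u w.2).

Lemma big_tcons T (Z : @trajectory X U T.+1 -> R) :
  \sum_w Z w = \sum_x \sum_u \sum_(w : @trajectory X U T) Z (tcons x u w).
Proof.
pose h (p : (X * U) * @trajectory X U T) := tcons p.1.1 p.1.2 p.2.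
pose h' (w : @trajectory X U T.+1) : (X * U) * @trajectory X U T :=
  ((w.1 ord0, w.2 ord0),
   ([ffun i => w.1 (lift ord0 i)], [ffun i => w.2 (lift ord0 i)])).
have hK' : cancel h h'.
  move=> [[x u] [s v]]; rewrite /h /h' /= !fcons0; congr (_, (_, _)).
    by apply/ffunP => i; rewrite ffunE fconsS.
  by apply/ffunP => i; rewrite ffunE fconsS.
have h'K : cancel h' h.
  move=> [s v]; rewrite /h /h' /tcons /=; congr (_, _); apply/ffunP => i.
    by rewrite ffunE; case: unliftP => [j|] ->; rewrite ?ffunE.
  by rewrite ffunE; case: unliftP => [j|] ->; rewrite ?ffunE.
rewrite (reindex h); last by exists h' => w _; [exact: hK'|exact: h'K].
rewrite pair_big_dep /= pair_big_dep /=.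
by apply: eq_bigr => -[[x u] w].
Qed.

(** Only [y = w.1 ord0] contributes to the sum; keeping the sum produces the one-step recursion of
    [law_step]. *)
Lemma law_tcons Q x T (x' : X) u (w : @trajectory X U T) :
  law Q x (tcons x' u w) =
  (x' == x)%:R * Q 0%N x' u * \sum_y K x' u y * law (Q \o S) y w.
Proof.
rewrite /law /= fcons0 big_ord_recl -!mulrA; congr (_ * _).
rewrite /state_at /action_at /next_state /=.
have -> : widen_ord (leqnSn T.+1) ord0 = ord0 by exact: val_inj.
rewrite !fcons0 fconsS; congr (_ * _).
rewrite (bigD1 (w.1 ord0)) //= eqxx mul1r [X in _ + X]big1 ?addr0; last first.
  by move=> y yN; rewrite eq_sym (negbTE yN) mul0r mulr0.
congr (_ * _); apply: eq_bigr => t _.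
have -> : widen_ord (leqnSn T.+1) (lift ord0 t) = lift ord0 (widen_ord (leqnSn T) t).
  exact: val_inj.
by rewrite !fconsS.
Qed.

Lemma law_step Q x T (Z : @trajectory X U T.+1 -> R) :
  \sum_w law Q x w * Z w =
  \sum_u Q 0%N x u * \sum_y K x u y *
    \sum_(w : @trajectory X U T) law (Q \o S) y w * Z (tcons x u w).
Proof.
rewrite big_tcons (bigD1 x) //= [X in _ + X]big1 ?addr0; last first.
  move=> x' xN; rewrite big1// => u _; rewrite big1// => w _.
  by rewrite law_tcons (negbTE xN) !mul0r.
apply: eq_bigr => u _.
transitivity (\sum_(w : @trajectory X U T)
    Q 0%N x u * \sum_y K x u y * law (Q \o S) y w * Z (tcons x u w)).
  by apply: eq_bigr => w _; rewrite law_tcons eqxx mul1r -mulrA mulr_suml.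
rewrite -mulr_sumr exchange_big /=; congr (_ * _); apply: eq_bigr => y _.
by rewrite mulr_sumr; apply: eq_bigr => w _; rewrite mulrA.
Qed.

Lemma law_ge0 Q x T (w : @trajectory X U T) :
  (forall t, (t < T)%N -> markov_matrix (Q t)) -> 0 <= law Q x w.
Proof.
move=> hQ; rewrite mulr_ge0// prodr_ge0// => t _.
by apply: mulr_ge0; [exact: (hQ _ (ltn_ord t) _).1|exact: (hK _ _).1].
Qed.

Lemma law_mass Q x T : (forall t, (t < T)%N -> markov_matrix (Q t)) ->
  \sum_(w : @trajectory X U T) law Q x w = 1.
Proof.
elim: T Q x => [|T IH] Q x hQ.
  pose w0 : @trajectory X U 0 := ([ffun=> x], ffun0 (card_ord 0)).
  rewrite (bigD1 w0)//= /law big_ord0 mulr1 ffunE eqxx big1 ?addr0// => w wN.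
  rewrite big_ord0 mulr1; case: eqP => // e; case/eqP: wN.
  case: w e => s v /= e; congr (_, _); apply/ffunP; last by case.
  by move=> i; rewrite ffunE ord1 e.
under eq_bigr do rewrite -[law _ _ _]mulr1.
rewrite (law_step Q x (fun=> 1)) -[RHS](hQ 0%N isT x).2; apply: eq_bigr => u _.
rewrite -[RHS]mulr1 -[in RHS](hK x u).2; congr (_ * _); apply: eq_bigr => y _.
under eq_bigr do rewrite mulr1.
by rewrite (IH (Q \o S)) ?mulr1// => t tT; exact: (hQ t.+1).
Qed.

(** Induction on the horizon, removing the first round; the initial law is arbitrary because the
    remaining game starts from [push K (Q 0) mu]. *)
Lemma expected_cost Q T (g : nat -> E) mu :
  (forall t, (t < T)%N -> markov_matrix (Q t)) ->
  \sum_x mu x * \sum_(w : @trajectory X U T) law Q x w *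
     \sum_(t < T) ent (g t) (state_at w t) (action_at w t)
  = \sum_(t < T) dotp (otimes (state_law Q mu t) (Q t)) (g t).
Proof.
elim: T Q g mu => [|T IH] Q g mu hQ.
  rewrite [RHS]big_ord0 big1// => x _; rewrite big1 ?mulr0// => w _.
  by rewrite big_ord0 mulr0.
have hQ' t : (t < T)%N -> markov_matrix ((Q \o S) t) by move=> tT; exact: hQ.
(* The expected cost of the later rounds, started from [y]. *)
pose V y := \sum_(w : @trajectory X U T) law (Q \o S) y w *
   \sum_(t < T) ent (g t.+1) (state_at w t) (action_at w t).
have costE x u (w : @trajectory X U T) :
    \sum_(t < T.+1) ent (g t) (state_at (tcons x u w) t) (action_at (tcons x u w) t)
    = ent (g 0%N) x u + \sum_(t < T) ent (g t.+1) (state_at w t) (action_at w t).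
  rewrite big_ord_recl /state_at /action_at /=.
  have -> : widen_ord (leqnSn T.+1) ord0 = ord0 by exact: val_inj.
  rewrite !fcons0; congr (_ + _); apply: eq_bigr => t _.
  have -> : widen_ord (leqnSn T.+1) (lift ord0 t) = lift ord0 (widen_ord (leqnSn T) t).
    exact: val_inj.
  by rewrite !fconsS.
have IHV : \sum_y push K (Q 0%N) mu y * V y =
    \sum_(t < T) dotp (otimes (state_law Q mu t.+1) (Q t.+1)) (g t.+1).
  rewrite (IH (Q \o S) (g \o S) _ hQ'); apply: eq_bigr => t _.
  by rewrite state_law_shift.
rewrite big_ord_recl -[X in _ = _ + X]IHV dotp_ent.
have step x : \sum_(w : @trajectory X U T.+1) law Q x w *
     \sum_(t < T.+1) ent (g t) (state_at w t) (action_at w t) =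
    \sum_u Q 0%N x u * (ent (g 0%N) x u + \sum_y K x u y * V y).
  rewrite law_step; apply: eq_bigr => u _; congr (_ * _).
  rewrite -[ent (g 0%N) x u]mul1r -(hK x u).2 mulr_suml -big_split /=.
  apply: eq_bigr => y _; rewrite -mulrDr; congr (_ * _).
  under eq_bigr do rewrite costE mulrDr.
  by rewrite big_split -mulr_suml (law_mass _ hQ') mul1r.
under eq_bigr do rewrite step mulr_sumr.
clearbody V.
have -> : \sum_y push K (Q 0%N) mu y * V y =
    \sum_x \sum_u mu x * Q 0%N x u * \sum_y K x u y * V y.
  rewrite /push; under eq_bigr do rewrite mulr_suml.
  rewrite exchange_big; apply: eq_bigr => x _ /=.
  under eq_bigr do rewrite mulr_sumr mulr_suml.
  rewrite exchange_big; apply: eq_bigr => u _ /=.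
  by rewrite mulr_sumr; apply: eq_bigr => y _; ring.
rewrite -big_split; apply: eq_bigr => x _ /=; rewrite -big_split; apply: eq_bigr => u _ /=.
by rewrite ent_otimes; ring.
Qed.

End Trajectories.

End MarkovChains.

(** * The game on the state-action polytope *)

Section ObliviousGame.
Context {R : realType} {X U : finType}.
Local Notation E := 'M[R]_(#|X|, #|U|).
Variable K : X -> U -> X -> R.
Hypothesis hK : forall x u, is_dist (K x u).

Lemma polytope_convex (v w : E) (t : R) : polytope K v -> polytope K w ->
  0 <= t <= 1 -> polytope K (v + t *: (w - v)).
Proof.
move=> [v0 v1 vK] [w0 w1 wK] /andP[t0 t1].
have entE x u : ent (v + t *: (w - v)) x u = (1 - t) * ent v x u + t * ent w x u.
  by rewrite /ent !mxE; ring.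
split=> [x u||y].
- by rewrite entE addr_ge0// mulr_ge0// subr_ge0.
- under eq_bigr do under eq_bigr do rewrite entE.
  under eq_bigr do rewrite big_split /= -!mulr_sumr.
  by rewrite big_split /= -!mulr_sumr v1 w1; ring.
- under eq_bigr do under eq_bigr do rewrite entE mulrDr mulrCA [K _ _ _ * (t * _)]mulrCA.
  under eq_bigr do rewrite big_split /= -!mulr_sumr.
  rewrite big_split /= -!mulr_sumr vK wK.
  under [RHS]eq_bigr do rewrite entE.
  by rewrite [RHS]big_split /= -!mulr_sumr.
Qed.

Lemma norm_dotp_polytope (f v : E) : polytope K v -> `|dotp f v| <= `|f|.
Proof.
move=> [v0 v1 _]; rewrite dotp_ent -[leRHS]mulr1 -v1 mulr_sumr.
apply: le_trans (ler_norm_sum _ _ _) _; apply: ler_sum => x _.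
rewrite mulr_sumr; apply: le_trans (ler_norm_sum _ _ _) _; apply: ler_sum => u _.
by rewrite normrM (ger0_norm (v0 x u)) ler_wpM2r// normr_ent_le.
Qed.

Lemma policy_drift_ge0 T (gam : strategy) (f : T.-tuple E) : 0 <= policy_drift gam f.
Proof. exact: bigmax_ge_id. Qed.

Lemma l1dist_le_policy_drift T (gam : strategy) (f : T.-tuple E) (t : nat) (y : X) :
  (t.+1 < T)%N -> l1dist (gam (take t f) y) (gam (take t.+1 f) y) <= policy_drift gam f.
Proof.
move=> tT; rewrite /policy_drift.
apply: (@le_trans _ _ (\big[Num.max/0]_(y : X)
    l1dist (gam (take t f) y) (gam (take t.+1 f) y))).
  exact: (le_bigmax 0 (fun y => l1dist (gam (take t f) y) (gam (take t.+1 f) y)) y).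
have := @le_bigmax_seq _ R nat (index_iota 1 T) 0 t.+1 xpredT
  (fun t => \big[Num.max/0]_(y : X) l1dist (gam (take t.-1 f) y) (gam (take t f) y)).
by rewrite mem_index_iota; apply.
Qed.

Section Expectation.
Variables (T : nat) (f : T.-tuple E) (gam : @strategy R X U).
Hypothesis hgam : forall t : nat, (t < T)%N -> markov_matrix (gam (take t f)).

Let Q (t : nat) := gam (take t f).

Lemma expected_total_cost x :
  \sum_w traj_law K gam f x w * total_cost f w =
  \sum_(t < T) dotp (otimes (state_law K Q (fun y => (y == x)%:R) t) (Q t)) f`_t.
Proof.
rewrite -(expected_cost hK (fun t => f`_t) _ hgam) (bigD1 x) //= eqxx mul1r.
rewrite [X in _ = _ + X]big1 ?addr0; last by move=> y /negbTE ->; rewrite mul0r.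
apply: eq_bigr => w _; congr (_ * _); apply: eq_bigr => t _.
by rewrite (tnth_nth 0).
Qed.

Lemma expect_sub_fin x (b : R) :
  expect K gam f x (fun w => (total_cost f w)%:E - b%:E)%E
  = (\sum_w traj_law K gam f x w * total_cost f w - b)%:E.
Proof.
rewrite /expect; under eq_bigr do rewrite -EFinB -EFinM.
rewrite sumEFin; congr (_%:E); under eq_bigr do rewrite mulrBr.
by rewrite sumrB -mulr_suml (law_mass hK x hgam) mul1r.
Qed.

(** Total mass one provides a trajectory of positive probability, whose term [-oo] absorbs all the
    others. *)
Lemma expect_sub_pinfty x :
  expect K gam f x (fun w => (total_cost f w)%:E - +oo)%E = -oo%E.
Proof.
have [w w_gt0] : exists w : trajectory T, 0 < law K Q x w.
  apply: contrapT => H; have := law_mass hK x hgam; rewrite big1.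
    by move=> /eqP; rewrite eq_sym oner_eq0.
  move=> w _; apply/eqP; rewrite eq_le (law_ge0 hK x w hgam) andbT leNgt.
  by apply/negP => w_gt0; apply: H; exists w.
rewrite /expect (bigD1 w) //= addeNy gt0_muleNy ?lte_fin//.
Qed.

End Expectation.

End ObliviousGame.

Theorem theorem6 (R : realType) (X U : finType) (K : X -> U -> X -> R)
  (hK : forall x u, is_dist (K x u))
  (Fcal : set 'M[R]_(#|X|, #|U|))
  (T : nat) (hT : (0 < T)%N)
  (hint : relint (polytope K) !=set0)
  (F : 'M[R]_(#|X|, #|U|) -> R)
  (hF : mirror_barrier (polytope K) F)
  (G' : set 'M[R]_(#|X|, #|U|)) (hG' : G' `<=` relint (polytope K))
  (f : T.-tuple 'M[R]_(#|X|, #|U|)) (hf : forall t, Fcal (tnth f t))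
  (rho : R) (hrho : 0 < rho)
  (gam : strategy)
  (hgam : forall t : 'I_T,
     induced_policy (md (polytope K) F rho (take t f)) (gam (take t f)))
  (hstep : forall t : 'I_T,
     rho * dual_norm (polytope K) F
             (grad (direction (polytope K)) F
                (md (polytope K) F rho (take t f)))
             (tnth f t) <= 1 / 2)
  (hnorm : forall t : 'I_T,
     dual_norm (polytope K) F
       (grad (direction (polytope K)) F (md (polytope K) F rho (take t f)))
       (tnth f t) <= 1)
  (tau : R) (hmix : uniform_mixing K tau)
  (V : seq 'M[R]_(#|X|, #|U|) -> \bar R)
  (hV : forall t, (t <= T)%N ->
     V (take t f) = md_relaxation (polytope K) F rho T G' (take t f))
  (x : X) :
  let CF := ereal_sup [set (`|g|)%:E | g in Fcal] in
  let DF := ereal_sup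
    [set (bregman (polytope K) F nu (md_init (polytope K) F))%:E | nu in G'] in
  (expect K gam f x (fun w => (total_cost f w)%:E - best_cost K G' f)
   <= DF * (rho^-1)%:E + (2 * rho * T%:R)%:E
      + CF * ((tau + 1) ^+ 2 * T%:R * policy_drift gam f)%:E
      + (2 * tau + 2)%:E * CF)%E.
Proof.
cbv zeta; set CF := ereal_sup [set `|g|%:E | g in Fcal].
set DF := ereal_sup [set (bregman _ F nu _)%:E | nu in G'].
have cvx := @polytope_convex R X U K.
have bnd (g : 'M[R]_(#|X|, #|U|)) : exists M, forall v, polytope K v -> `|dotp g v| <= M.
  by exists `|g| => v; exact: norm_dotp_polytope.
pose nu1 := md_init (polytope K) F.
have Snu1 : relint (polytope K) nu1 by exact: (md_initP hF).
pose nu t := md (polytope K) F rho (take t f).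
have Snu t : relint (polytope K) (nu t) by exact: (md_relint cvx bnd hF).
have hQ t (tT : (t < T)%N) : induced_policy (nu t) (gam (take t f)) := hgam (Ordinal tT).
have mQ t (tT : (t < T)%N) : markov_matrix (gam (take t f)) := (hQ t tT).1.
have fE t (tT : (t < T)%N) : tnth f (Ordinal tT) = f`_t := tnth_nth 0 f (Ordinal tT).
have tau0 : 0 < tau by apply: lt_le_trans hmix.1.
have kap0 : 0 < 2 * tau + 2 by rewrite addr_gt0// mulr_gt0.
have drift0 := policy_drift_ge0 gam f.
have drc0 : 0 <= (tau + 1) ^+ 2 * T%:R * policy_drift gam f.
  by rewrite mulr_ge0// mulr_ge0// sqr_ge0.
have rhoT0 : 0 <= 2 * rho * T%:R by rewrite !mulr_ge0// ltW.
(* Without comparison policies the infimum is [+oo] and the expected regret [-oo]. *)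
have [P0|/set0P[P [mu0 Gmu0 hP]]] := eqVneq (policies G') set0.
  by rewrite /best_cost P0 image_set0 ereal_inf0 (expect_sub_pinfty hK mQ) leNye.
have CFge t (tT : (t < T)%N) : (`|f`_t|%:E <= CF)%E.
  by apply: ereal_sup_ubound; exists (tnth f (Ordinal tT)) => //; rewrite fE.
(* A positive horizon provides a member of [Fcal], which excludes a supremum equal to [-oo]. *)
have CF0 : (0 <= CF)%E by apply: le_trans (CFge 0%N hT); rewrite lee_fin.
have DFge mu : G' mu -> ((bregman (polytope K) F mu nu1)%:E <= DF)%E.
  by move=> Gmu; apply: ereal_sup_ubound; exists mu.
have DF0 : (0 <= DF)%E.
  apply: le_trans (DFge _ Gmu0); rewrite lee_fin.
  exact: (bregman_ge0 hF (hG' _ Gmu0) Snu1).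
have rhoV0 : 0 < rho^-1 by rewrite invr_gt0.
have base0 (a b c : \bar R) : (0 <= a -> 0 <= b -> 0 <= c -> 0 <= a + b + c)%E.
  by move=> *; rewrite !adde_ge0.
(* An infinite [CF] or, next, an infinite [DF] makes the right-hand side [+oo]: its other summands
   are not [-oo]. *)
case: CF CF0 CFge => [c|_ _|//]; last first.
  rewrite gt0_muley ?lte_fin// addey ?leey// gt_eqF// (lt_le_trans (ltNyr 0))//.
  by apply: base0; rewrite ?mule_ge0 ?lee_fin// ltW.
case: DF DF0 DFge => [d|_ _|//]; last first.
  rewrite gt0_mulye ?lte_fin// => c0 _.
  by rewrite leey.
move=> d0 DFge c0 CFge.
rewrite lee_fin in c0.
pose B := d * rho^-1 + 2 * rho * T%:R + c * ((tau + 1) ^+ 2 * T%:R * policy_drift gam f)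
  + (2 * tau + 2) * c.
pose EC := \sum_w traj_law K gam f x w * total_cost f w.
have comparator mu P' : G' mu -> induced_policy mu P' ->
    \sum_(t < T) dotp (otimes (inv_dist K P') P') (tnth f t) = \sum_(t < T) dotp mu f`_t.
  move=> Gmu hP'; have Cmu := relint_sub (hG' _ Gmu).
  rewrite (inv_distE hmix Cmu hP') (otimes_marginal Cmu hP').
  by apply: eq_bigr => t _; rewrite (tnth_nth 0).
(* A lower bound uniform in the comparator, so that it passes to the infimum without the latter
   being attained. *)
have main mu : G' mu -> EC - B <= \sum_(t < T) dotp mu f`_t.
  move=> Gmu.
  have dirac : is_dist (fun y => (y == x)%:R : R).
    split=> [y|]; first by rewrite ler0n.
    by rewrite (bigD1 x) //= eqxx big1 ?addr0// => y /negbTE ->.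
  have track := tracking_cost (nus := nu) (g := fun t => f`_t)
    (Q := fun t => gam (take t f)) hK hmix drift0 c0 dirac
    (fun t _ => relint_sub (Snu t)) hQ
    (fun t y tT => l1dist_le_policy_drift gam f y tT)
    (fun t tT => ltac:(by have := CFge t tT; rewrite lee_fin)).
  rewrite -(expected_total_cost hK mQ) -/EC in track.
  have sz : size f = T by rewrite size_tuple.
  have reg : \sum_(t < T) (dotp (nu t) f`_t - dotp mu f`_t)
      <= d * rho^-1 + 2 * rho * T%:R.
    have := mirror_descent_regret cvx bnd hF (fs := f) hrho _ (hG' _ Gmu).
    rewrite sz => /(_ _)/le_trans; apply.
      move=> t tT; have := hstep (Ordinal tT); have := hnorm (Ordinal tT).
      by rewrite fE.
    (* The divergence from the last iterate enters with a minus sign and is dropped. *)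
    have b0 := bregman_ge0 hF (hG' _ Gmu) (md_relint cvx bnd hF rho f).
    have b1 : 0 <= rho^-1 * bregman (polytope K) F mu (md (polytope K) F rho f).
      by rewrite mulr_ge0// ltW.
    have := DFge _ Gmu; rewrite lee_fin => /(ler_wpM2l (ltW rhoV0)); rewrite /nu1; lra.
  rewrite sumrB in reg; rewrite /B; move: track reg; rewrite /nu; lra.
have lbB : ((EC - B)%:E <= best_cost K G' f)%E.
  apply: le_ereal_inf_tmp => _ [P' [mu Gmu hP'] <-]; rewrite lee_fin (comparator mu)//.
  exact: main.
(* With [lbB] this makes the comparator finite, so the expectation may be split. *)
have ubB : (best_cost K G' f < +oo)%E.
  apply: (@le_lt_trans _ _ (\sum_(t < T) dotp (otimes (inv_dist K P) P) (tnth f t))%:E).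
    by apply: ereal_inf_lbound; exists P => //; exists mu0.
  by rewrite ltry.
case: (best_cost K G' f) lbB ubB => [b|//|//].
rewrite lee_fin => lbB _; rewrite (expect_sub_fin hK mQ) -/EC.
by rewrite -!EFinM -!EFinD lee_fin -/B; move: lbB; lra.
Qed.
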